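(* Assume the consistency of ZF. Then there is a model of $\mathrm{ZFU}_{\mathrm{R}}$ in which Plenitude holds, Collection fails, and Duplication fails.
   Context: The language of urelement set theory has $\in$ and a unary predicate $\mathcal{A}$ for urelements. $\mathrm{ZFU}_{\mathrm{R}}$ = ZU (urelements have no members, Extensionality for sets, Foundation, Pairing, Union, Powerset, Infinity, Separation scheme) + Replacement scheme. Plenitude: for every (well-ordered, pure) cardinal $\kappa$ there is a set of urelements equinumerous with $\kappa$. Collection: for every formula $\varphi$, $\forall w,u(\forall x\in w\,\exists y\,\varphi(x,y,u)\to\exists v\,\forall x\in w\,\exists y\in v\,\varphi(x,y,u))$. Duplication: every set $A$ of urelements has a set of urelements disjoint from $A$ and equinumerous with $A$. *)

(* Defs.v *)
From Stdlib Require Import List PeanoNat.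
Import ListNotations.

Set Implicit Arguments.

(* * First-order logic with equality, without function symbols

   [form U] is the set of formulas over equality, the binary symbol [∈] and one
   unary predicate symbol for each element of [U].  Variables are de Bruijn
   indices: a quantifier binds index 0 and shifts the others by one.  Since
   variables are the only terms, substitution is renaming. *)

Inductive form (U : Type) : Type :=
| Pred : U -> nat -> form U
| Mem : nat -> nat -> form U
| Eq : nat -> nat -> form U
| Bot : form U
| Imp : form U -> form U -> form U
| And : form U -> form U -> form U
| Or : form U -> form U -> form U
| All : form U -> form U
| Ex : form U -> form U.

Arguments Mem {U} _ _.
Arguments Eq {U} _ _.
Arguments Bot {U}.

Declare Scope fol_scope.
Delimit Scope fol_scope with fol.
Bind Scope fol_scope with form.

Notation "x ∈ y" := (Mem x y) (at level 70) : fol_scope.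
Notation "x ≡ y" := (Eq x y) (at level 70) : fol_scope.
Notation "⊥" := Bot : fol_scope.
Notation "¬ φ" := (Imp φ Bot) (at level 75, right associativity) : fol_scope.
Notation "φ ∧ ψ" := (And φ ψ) (at level 80, right associativity) : fol_scope.
Notation "φ ∨ ψ" := (Or φ ψ) (at level 85, right associativity) : fol_scope.
Notation "φ ⟶ ψ" := (Imp φ ψ) (at level 90, right associativity) : fol_scope.
Notation "φ ⟷ ψ" := (And (Imp φ ψ) (Imp ψ φ)) (at level 95) : fol_scope.
Notation "∀, φ" := (All φ) (at level 10, φ at level 200) : fol_scope.
Notation "∃, φ" := (Ex φ) (at level 10, φ at level 200) : fol_scope.
Notation "∀∈ x , φ" := (All (Imp (Mem 0 (S x)) φ))
  (at level 10, x at level 60, φ at level 200) : fol_scope.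
Notation "∃∈ x , φ" := (Ex (And (Mem 0 (S x)) φ))
  (at level 10, x at level 60, φ at level 200) : fol_scope.

Definition theory (U : Type) : Type := form U -> Prop.

Definition up (r : nat -> nat) (k : nat) : nat :=
  match k with 0 => 0 | S k => S (r k) end.

Fixpoint ren {U : Type} (r : nat -> nat) (φ : form U) : form U :=
  match φ with
  | Pred u x => Pred u (r x)
  | Mem x y => Mem (r x) (r y)
  | Eq x y => Eq (r x) (r y)
  | Bot => Bot
  | Imp φ ψ => Imp (ren r φ) (ren r ψ)
  | And φ ψ => And (ren r φ) (ren r ψ)
  | Or φ ψ => Or (ren r φ) (ren r ψ)
  | All φ => All (ren (up r) φ)
  | Ex φ => Ex (ren (up r) φ)
  end.

(* [args [x0; ..; xn] d] sends the variables 0, .., n to x0, .., xn and the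
   following ones (the parameters) to d, d+1, d+2, ... *)
Definition args (l : list nat) (d k : nat) : nat :=
  nth k l (d + (k - length l)).

(* All free variables of φ are < [bound φ]. *)
Fixpoint bound {U : Type} (φ : form U) : nat :=
  match φ with
  | Pred _ x => S x
  | Mem x y | Eq x y => Nat.max (S x) (S y)
  | Bot => 0
  | Imp φ ψ | And φ ψ | Or φ ψ => Nat.max (bound φ) (bound ψ)
  | All φ | Ex φ => Nat.pred (bound φ)
  end.

(* Universal closure. *)
Definition close {U : Type} (φ : form U) : form U :=
  Nat.iter (bound φ) (@All U) φ.

(* ** Classical natural deduction *)

Inductive derives {U : Type} : list (form U) -> form U -> Prop :=
| D_hyp Γ φ : In φ Γ -> derives Γ φ
| D_raa Γ φ : derives (Imp φ Bot :: Γ) Bot -> derives Γ φ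
| D_impI Γ φ ψ : derives (φ :: Γ) ψ -> derives Γ (Imp φ ψ)
| D_impE Γ φ ψ : derives Γ (Imp φ ψ) -> derives Γ φ -> derives Γ ψ
| D_andI Γ φ ψ : derives Γ φ -> derives Γ ψ -> derives Γ (And φ ψ)
| D_andE1 Γ φ ψ : derives Γ (And φ ψ) -> derives Γ φ
| D_andE2 Γ φ ψ : derives Γ (And φ ψ) -> derives Γ ψ
| D_orI1 Γ φ ψ : derives Γ φ -> derives Γ (Or φ ψ)
| D_orI2 Γ φ ψ : derives Γ ψ -> derives Γ (Or φ ψ)
| D_orE Γ φ ψ χ : derives Γ (Or φ ψ) ->
    derives (φ :: Γ) χ -> derives (ψ :: Γ) χ -> derives Γ χ
| D_allI Γ φ : derives (map (ren S) Γ) φ -> derives Γ (All φ)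
| D_allE Γ φ t : derives Γ (All φ) -> derives Γ (ren (args [t] 0) φ)
| D_exI Γ φ t : derives Γ (ren (args [t] 0) φ) -> derives Γ (Ex φ)
| D_exE Γ φ ψ : derives Γ (Ex φ) ->
    derives (φ :: map (ren S) Γ) (ren S ψ) -> derives Γ ψ
| D_eqI Γ x : derives Γ (Eq x x)
| D_eqE Γ φ x y : derives Γ (Eq x y) ->
    derives Γ (ren (args [x] 0) φ) -> derives Γ (ren (args [y] 0) φ).

Definition consistent {U : Type} (T : theory U) : Prop :=
  ~ exists Γ : list (form U), (forall φ, In φ Γ -> T φ) /\ derives Γ Bot.

(* ** Structures and satisfaction *)

Record structure (U : Type) : Type := {
  dom :> Type;
  dom_inhabited : inhabited dom;
  pred : U -> dom -> Prop;
  mem : dom -> dom -> Prop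
}.

Definition scons {X : Type} (a : X) (e : nat -> X) (k : nat) : X :=
  match k with 0 => a | S k => e k end.

Fixpoint sat {U : Type} (M : structure U) (e : nat -> M) (φ : form U) : Prop :=
  match φ with
  | Pred u x => pred M u (e x)
  | Mem x y => mem M (e x) (e y)
  | Eq x y => e x = e y
  | Bot => False
  | Imp φ ψ => sat M e φ -> sat M e ψ
  | And φ ψ => sat M e φ /\ sat M e ψ
  | Or φ ψ => sat M e φ \/ sat M e ψ
  | All φ => forall a : M, sat M (scons a e) φ
  | Ex φ => exists a : M, sat M (scons a e) φ
  end.

Definition holds {U : Type} (M : structure U) (φ : form U) : Prop :=
  forall e : nat -> M, sat M e φ.

Definition models {U : Type} (M : structure U) (T : theory U) : Prop :=
  forall φ, T φ -> holds M φ.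

(* * Axioms of set theory

   [isset x] is the formula expressing that x is a set. *)

Section SetTheory.
Local Open Scope fol_scope.
Context {U : Type} (isset : nat -> form U).

Definition extensionality : form U :=
  ∀, ∀, isset 0 ∧ isset 1 ∧ (∀, 0 ∈ 1 ⟷ 0 ∈ 2) ⟶ 0 ≡ 1.

Definition foundation : form U :=
  ∀, (∃, 0 ∈ 1) ⟶ ∃∈ 0, ¬ ∃, 0 ∈ 1 ∧ 0 ∈ 2.

Definition pairing : form U :=
  ∀, ∀, ∃, isset 0 ∧ ∀, 0 ∈ 1 ⟷ 0 ≡ 2 ∨ 0 ≡ 3.

Definition union : form U :=
  ∀, ∃, isset 0 ∧ ∀, 0 ∈ 1 ⟷ ∃∈ 2, 1 ∈ 0.

Definition powerset : form U :=
  ∀, ∃, isset 0 ∧ ∀, 0 ∈ 1 ⟷ isset 0 ∧ ∀∈ 0, 0 ∈ 3.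

Definition infinity : form U :=
  ∃, isset 0
     ∧ (∃∈ 0, isset 0 ∧ ∀, ¬ 0 ∈ 1)
     ∧ (∀∈ 0, ∃∈ 1, isset 0 ∧ ∀, 0 ∈ 1 ⟷ 0 ∈ 2 ∨ 0 ≡ 2).

(* In the schemes, φ(z,u) has z as variable 0 and φ(x,y,u) has x as variable 0
   and y as variable 1; all further variables are the parameters u, which the
   universal closure quantifies. *)

(* ∀w ∃s ∀z (z ∈ s ⟷ z ∈ w ∧ φ(z,u)) *)
Definition separation (φ : form U) : form U :=
  close (∀, ∃, isset 0 ∧ ∀, 0 ∈ 1 ⟷ 0 ∈ 2 ∧ ren (args [0] 3) φ).

(* ∀w (∀x∈w ∃!y φ(x,y,u) ⟶ ∃v ∀x∈w ∃y∈v φ(x,y,u)), where ∃!y φ(y) is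
   ∃y ∀y' (φ(y') ⟷ y' ≡ y) *)
Definition replacement (φ : form U) : form U :=
  close (∀, (∀∈ 0, ∃, ∀, ren (args [2; 0] 4) φ ⟷ 0 ≡ 1)
            ⟶ ∃, ∀∈ 1, ∃∈ 1, ren (args [1; 0] 4) φ).

(* ∀w (∀x∈w ∃y φ(x,y,u) ⟶ ∃v ∀x∈w ∃y∈v φ(x,y,u)) *)
Definition collection (φ : form U) : form U :=
  close (∀, (∀∈ 0, ∃, ren (args [1; 0] 3) φ)
            ⟶ ∃, ∀∈ 1, ∃∈ 1, ren (args [1; 0] 4) φ).

Inductive ZF_axioms : theory U :=
| ZF_extensionality : ZF_axioms extensionality
| ZF_foundation : ZF_axioms foundation
| ZF_pairing : ZF_axioms pairing
| ZF_union : ZF_axioms union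
| ZF_powerset : ZF_axioms powerset
| ZF_infinity : ZF_axioms infinity
| ZF_separation φ : ZF_axioms (separation φ)
| ZF_replacement φ : ZF_axioms (replacement φ).

Inductive Collection : theory U :=
| Collection_instance φ : Collection (collection φ).

End SetTheory.

(* The language {∈}, in which every object is a set. *)
Definition ZF : theory Empty_set := ZF_axioms (fun _ => Imp Bot Bot).

(* * Set theory with urelements, in the language {∈, 𝒜} *)

Section Urelements.
Local Open Scope fol_scope.

Definition lang : Type := unit.
Definition 𝒜 (x : nat) : form lang := Pred tt x.
Definition isset (x : nat) : form lang := ¬ 𝒜 x.

Definition urelements_empty : form lang := ∀, 𝒜 0 ⟶ ¬ ∃, 0 ∈ 1.

Inductive ZFU_R : theory lang :=
| ZFU_urelements : ZFU_R urelements_empty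
| ZFU_ZF φ : ZF_axioms isset φ -> ZFU_R φ.

(* p = {a, b} *)
Definition upair (p a b : nat) : form lang :=
  ∀, 0 ∈ 1 + p ⟷ 0 ≡ 1 + a ∨ 0 ≡ 1 + b.

(* p = (a, b) = {{a}, {a, b}} *)
Definition opair (p a b : nat) : form lang :=
  ∀, 0 ∈ 1 + p ⟷ upair 0 (1 + a) (1 + a) ∨ upair 0 (1 + a) (1 + b).

(* (a, b) ∈ f *)
Definition app (f a b : nat) : form lang :=
  ∃∈ f, opair 0 (1 + a) (1 + b).

(* f ⊆ x × y, every a ∈ x has exactly one b with (a, b) ∈ f, and every b ∈ y
   has exactly one a with (a, b) ∈ f *)
Definition bijection (f x y : nat) : form lang :=
  isset f
  ∧ (∀∈ f, ∃∈ 1 + x, ∃∈ 2 + y, opair 2 1 0)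
  ∧ (∀∈ x, ∃, ∀, app (3 + f) 2 0 ⟷ 0 ≡ 1)
  ∧ (∀∈ y, ∃, ∀, app (3 + f) 0 2 ⟷ 0 ≡ 1).

Definition equinumerous (x y : nat) : form lang :=
  ∃, bijection 0 (1 + x) (1 + y).

Definition transitive (x : nat) : form lang := ∀∈ x, ∀∈ 0, 0 ∈ 2 + x.

Definition well_ordered (x : nat) : form lang :=
  (∀∈ x, ¬ 0 ∈ 0)
  ∧ (∀∈ x, ∀∈ 1 + x, ∀∈ 2 + x, 2 ∈ 1 ∧ 1 ∈ 0 ⟶ 2 ∈ 0)
  ∧ (∀∈ x, ∀∈ 1 + x, 1 ∈ 0 ∨ 1 ≡ 0 ∨ 0 ∈ 1)
  ∧ (∀, isset 0 ∧ (∀∈ 0, 0 ∈ 2 + x) ∧ (∃, 0 ∈ 1)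
        ⟶ ∃∈ 0, ∀∈ 1, 1 ≡ 0 ∨ 1 ∈ 0).

(* A transitive set is pure iff all its members are sets. *)
Definition ordinal (x : nat) : form lang :=
  isset x ∧ transitive x ∧ (∀∈ x, isset 0) ∧ well_ordered x.

Definition cardinal (x : nat) : form lang :=
  ordinal x ∧ ∀∈ x, ¬ equinumerous 0 (1 + x).

Definition set_of_urelements (x : nat) : form lang :=
  isset x ∧ ∀∈ x, 𝒜 0.

Definition Plenitude : form lang :=
  ∀, cardinal 0 ⟶ ∃, set_of_urelements 0 ∧ equinumerous 0 1.

Definition Duplication : form lang :=
  ∀, set_of_urelements 0
     ⟶ ∃, set_of_urelements 0 ∧ (¬ ∃, 0 ∈ 1 ∧ 0 ∈ 2) ∧ equinumerous 0 1.

End Urelements.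

(* Main.v *)
(* By the completeness theorem there is a model V of ZF.  Inside V, read a
   nonempty set as an urelement if ∅ is not among its members and as the set of
   its members other than ∅ if it is; this makes V \ {∅} a universe of sets over
   a proper class of urelements, among them all ordered pairs.

   Arrange the urelements (n, k, x), n and x natural numbers and k arbitrary, into
   columns (n, k).  For each n, transpositions of rows act on all the columns (n, k)
   simultaneously, and transpositions of the k ≠ ∅ exchange whole columns.  Keep
   the hereditarily symmetric sets, where y is symmetric if for some m it is fixed
   by all transpositions of rows x, x' >= m and all transpositions of columns with
   n >= m.  Each transposition commutes with those of a high enough level m, so it
   preserves symmetry, and sets defined from symmetric parameters are symmetric:
   this is a model of ZFU_R.  Plenitude holds because of the fixed urelements.

   There is a proper class of k, so for large n a symmetric set of urelements
   contains no element of a column (n, k) with k ≠ ∅.  If it is also disjoint from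
   the set A of all (n, ∅, x), then it has no bijection onto the column (n, ∅): a
   row transposition that fixes the bijection moves the column but not the set.
   Hence A has no disjoint copy.  Collection fails for the statement that every
   column (n, ∅) has a copy disjoint from A, namely (n, {∅}). *)

(* [V] is an arbitrary first-order model: seen from outside, its membership may be ill-founded and
   its [ω] may have nonstandard members. Every induction, recursion and collection therefore takes
   place inside [V] and needs a definable predicate, which is why a proof of [Def] accompanies each
   notion.

   The two kinds of transposition have separate tasks. Column exchanges spread an occurrence of (n,
   k, x) with k ≠ ∅ over a proper class, so a set with support m contains no such urelement for n >=
   m; as they enter level m only for these n, each single n still has copies of its column, with a
   larger support. Row transpositions destroy a bijection between the column (n, ∅) and urelements
   outside the index n; as they act on all columns of an index at once, they preserve the matching
   of (n, ∅) with (n, {∅}). Collection and Duplication both ask for one set, hence one support m,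
   that serves all n, and n = m is then the counterexample. *)
Require Import Defs.
From Stdlib Require Import List PeanoNat Lia Classical ClassicalEpsilon
  FunctionalExtensionality PropExtensionality ProofIrrelevance Cantor.
Import ListNotations.

Set Implicit Arguments.

(** * Renaming and satisfaction *)

Section Renaming.
Context {U : Type}.
Implicit Types (φ ψ : form U) (r s e : nat -> nat).

Definition inst (t : nat) : nat -> nat := args [t] 0.

Lemma inst_S t k : inst t (S k) = k.
Proof. unfold inst, args; simpl; destruct k; lia. Qed.

Lemma ren_bounded φ : forall r s,
  (forall k, k < bound φ -> r k = s k) -> ren r φ = ren s φ.
Proof.
  induction φ; simpl; intros r s H; f_equal;
    try (apply H; lia);
    try (apply IHφ1; intros; apply H; lia);
    try (apply IHφ2; intros; apply H; lia);
    try (apply IHφ; intros [|k] Hk; simpl; [reflexivity|f_equal; apply H; lia]).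
Qed.

Lemma ren_ext φ r s : (forall k, r k = s k) -> ren r φ = ren s φ.
Proof. intros H; apply ren_bounded; auto. Qed.

Lemma ren_id φ : forall r, (forall k, r k = k) -> ren r φ = φ.
Proof.
  induction φ; simpl; intros r H; f_equal; auto;
    apply IHφ; intros [|k]; simpl; auto.
Qed.

Lemma ren_ren φ : forall r s, ren r (ren s φ) = ren (fun k => r (s k)) φ.
Proof.
  induction φ; simpl; intros r s; f_equal; auto;
    rewrite IHφ; apply ren_ext; intros [|k]; reflexivity.
Qed.

Lemma ren_closed φ r : bound φ = 0 -> ren r φ = φ.
Proof.
  intros H. rewrite <- (@ren_id φ (fun k => k)) at 2 by reflexivity.
  apply ren_bounded; intros; lia.
Qed.

Lemma ren_inst r t φ : ren r (ren (inst t) φ) = ren (inst (r t)) (ren (up r) φ).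
Proof.
  rewrite !ren_ren; apply ren_ext; intros [|k]; simpl; [reflexivity|].
  now rewrite !inst_S.
Qed.

(** * Structural properties of derivations *)

Lemma derives_weaken (Γ : list (form U)) φ :
  derives Γ φ -> forall Δ, incl Γ Δ -> derives Δ φ.
Proof.
  assert (cons : forall (Γ Δ : list (form U)) ψ, incl Γ Δ -> incl (ψ :: Γ) (ψ :: Δ))
    by (intros; intros x [|]; simpl; auto).
  induction 1; intros Δ HΔ; try (econstructor; solve [eauto using incl_map]).
Qed.

Lemma derives_ren (Γ : list (form U)) φ :
  derives Γ φ -> forall r, derives (map (ren r) Γ) (ren r φ).
Proof.
  assert (shift : forall r (Γ : list (form U)),
    map (ren (up r)) (map (ren S) Γ) = map (ren S) (map (ren r) Γ)).
  { intros; rewrite !map_map; apply map_ext; intro; rewrite !ren_ren; reflexivity. }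
  induction 1; intros r; simpl in *; try (econstructor; solve [eauto using in_map]).
  - apply D_allI; rewrite <- shift; apply IHderives.
  - change (args [t] 0) with (inst t); rewrite ren_inst.
    apply D_allE, IHderives.
  - apply D_exI with (r t); change (args [r t] 0) with (inst (r t)).
    rewrite <- ren_inst; apply IHderives.
  - eapply D_exE; [apply IHderives1|].
    rewrite <- shift.
    replace (ren S (ren r ψ)) with (ren (up r) (ren S ψ)); [apply IHderives2|].
    rewrite !ren_ren; reflexivity.
  - change (args [y] 0) with (inst y); rewrite ren_inst.
    eapply D_eqE; [apply IHderives1|].
    change (args [r x] 0) with (inst (r x)); rewrite <- ren_inst; apply IHderives2.
Qed.

End Renaming.

(** * Coincidence, renaming and automorphisms *)

Section Satisfaction.
Context {U : Type} (M : structure U).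
Implicit Types (φ ψ : form U) (e : nat -> M).

Lemma sat_bounded φ : forall e e',
  (forall k, k < bound φ -> e k = e' k) -> sat M e φ <-> sat M e' φ.
Proof.
  induction φ; simpl; intros e e' H.
  1-3: now rewrite !H by lia.
  1: tauto.
  1-3: rewrite (IHφ1 e e'), (IHφ2 e e'); [tauto|intros; apply H; lia..].
  all: assert (Hs : forall a k, k < bound φ -> scons a e k = scons a e' k)
    by (intros a [|k] Hk; simpl; [reflexivity|apply H; lia]).
  - split; intros HH a; specialize (HH a); revert HH; apply IHφ; auto.
    intros; symmetry; auto.
  - split; intros [a HH]; exists a; revert HH; apply IHφ; auto.
    intros; symmetry; auto.
Qed.

Lemma sat_ext φ e e' : (forall k, e k = e' k) -> sat M e φ <-> sat M e' φ.
Proof. intros H; apply sat_bounded; auto. Qed.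

Lemma sat_ren φ : forall e r, sat M e (ren r φ) <-> sat M (fun k => e (r k)) φ.
Proof.
  assert (up_scons : forall a e r k,
    scons a e (up r k) = scons a (fun k => e (r k)) k) by (intros a e r [|k]; reflexivity).
  induction φ; simpl; intros e r; try tauto.
  1-3: now rewrite IHφ1, IHφ2.
  1: split; intros H a; specialize (H a); rewrite IHφ in *; revert H;
     apply sat_ext; intro; rewrite up_scons; reflexivity.
  split; intros [a H]; exists a; rewrite IHφ in *; revert H;
     apply sat_ext; intro; rewrite up_scons; reflexivity.
Qed.

(** Applied to the maps [move c] of the symmetric model: whatever is defined from parameters fixed
    by an automorphism is invariant under it. *)
Lemma sat_automorphism (f : M -> M) :
  (forall y, exists x, f x = y) -> (forall x y, f x = f y -> x = y) ->
  (forall u x, pred M u (f x) <-> pred M u x) ->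
  (forall x y, mem M (f x) (f y) <-> mem M x y) ->
  forall φ e, sat M (fun k => f (e k)) φ <-> sat M e φ.
Proof.
  intros Hsurj Hinj Hp Hm.
  assert (Hs : forall a e k, scons (f a) (fun k => f (e k)) k = f (scons a e k))
    by (intros a e [|k]; reflexivity).
  induction φ; simpl; intros e; auto.
  - split; [apply Hinj|now intros ->].
  - tauto.
  - now rewrite IHφ1, IHφ2.
  - now rewrite IHφ1, IHφ2.
  - now rewrite IHφ1, IHφ2.
  - split; intros H a.
    + rewrite <- IHφ, <- (sat_ext φ _ _ (Hs a e)); apply H.
    + destruct (Hsurj a) as [b <-]; rewrite (sat_ext φ _ _ (Hs b e)), IHφ; apply H.
  - split; intros [a H].
    + destruct (Hsurj a) as [b <-]; exists b.
      now rewrite (sat_ext φ _ _ (Hs b e)), IHφ in H.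
    + exists (f a); now rewrite (sat_ext φ _ _ (Hs a e)), IHφ.
Qed.

Lemma holds_iter_All φ n : holds M (Nat.iter n (@All U) φ) <-> holds M φ.
Proof.
  induction n; simpl; [tauto|]; rewrite <- IHn; split; intros H e.
  - specialize (H (fun k => e (S k)) (e 0)); revert H; apply sat_ext.
    intros [|k]; reflexivity.
  - intros a; apply H.
Qed.

Lemma holds_close φ : holds M (close φ) <-> holds M φ.
Proof. apply holds_iter_All. Qed.

End Satisfaction.

Lemma bound_close {U} (φ : form U) : bound (close φ) = 0.
Proof.
  assert (H : forall n, bound (Nat.iter n (@All U) φ) = bound φ - n)
    by (induction n; simpl; lia).
  unfold close; rewrite H; lia.
Qed.

(** * The completeness theorem *)

(* Henkin's construction for a theory of sentences.  A sentence has no free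
   variable, so the variables themselves serve as witnessing constants. *)
Section Completeness.
Context {U : Type} (code : form U -> nat) (code_inj : forall φ ψ, code φ = code ψ -> φ = ψ).
Context (T : theory U) (T_closed : forall φ, T φ -> bound φ = 0) (T_con : consistent T).
Implicit Types (φ ψ : form U).

Definition provable (S : theory U) φ : Prop :=
  exists Γ, (forall ψ, In ψ Γ -> T ψ \/ S ψ) /\ derives Γ φ.

Definition con (L : list (form U)) : Prop := ~ provable (fun ψ => In ψ L) Bot.

Definition decode (n : nat) : option (form U) :=
  match excluded_middle_informative (exists φ, code φ = n) with
  | left H => Some (proj1_sig (constructive_indefinite_description _ H))
  | right _ => None
  end.

Lemma decode_code φ : decode (code φ) = Some φ.
Proof.
  unfold decode; destruct excluded_middle_informative as [H|H].
  - destruct constructive_indefinite_description; simpl; f_equal; auto.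
  - destruct H; eauto.
Qed.

Definition fresh (L : list (form U)) : nat := list_max (map (@bound U) L).

Definition witness (L : list (form U)) φ : list (form U) :=
  match φ with Ex ψ => [ren (inst (fresh (φ :: L))) ψ] | _ => [] end.

(** An existential formula enters together with its witness, so the Henkin property needs no second
    pass. Negations are not added for rejected formulas: a formula rejected at its own code is
    refutable from that stage, which already gives completeness. *)
Fixpoint stage (n : nat) : list (form U) :=
  match n with
  | 0 => []
  | S n =>
    match decode n with
    | Some φ => if excluded_middle_informative (con (φ :: stage n))
                then witness (stage n) φ ++ φ :: stage n else stage n
    | None => stage n
    end
  end.

Definition limit φ : Prop := exists n, In φ (stage n).

Lemma provable_mono (S S' : theory U) φ :
  (forall ψ, S ψ -> S' ψ) -> provable S φ -> provable S' φ.
Proof. intros H (Γ & HΓ & D); exists Γ; split; [|exact D]. intros ψ Hψ; destruct (HΓ ψ Hψ); auto. Qed.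

Lemma provable_hyp (S : theory U) φ : S φ \/ T φ -> provable S φ.
Proof.
  intros H; exists [φ]; split; [|apply D_hyp; now left].
  intros ψ [<-|[]]; tauto.
Qed.

Lemma provable_cut (S : theory U) l φ :
  (forall ψ, In ψ l -> provable S ψ) -> derives l φ -> provable S φ.
Proof.
  revert φ; induction l as [|χ l IH]; intros φ Hl D.
  - exists []; split; [intros ψ []|exact D].
  - destruct (IH (Imp χ φ)) as (Γ & HΓ & D1); [intros; apply Hl; now right|now apply D_impI|].
    destruct (Hl χ) as (Γ' & HΓ' & D2); [now left|].
    exists (Γ ++ Γ'); split; [intros ψ Hψ; apply in_app_or in Hψ; destruct Hψ; auto|].
    eapply D_impE; eapply derives_weaken; eauto; intros x Hx; apply in_or_app; auto.
Qed.

Lemma provable_imp (S : theory U) φ ψ :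
  provable (fun χ => S χ \/ χ = φ) ψ -> provable S (Imp φ ψ).
Proof.
  intros (Γ & HΓ & D).
  assert (E : exists Δ, (forall χ, In χ Δ -> T χ \/ S χ) /\ incl Γ (φ :: Δ)).
  { clear D; induction Γ as [|χ Γ IH].
    - exists []; split; [intros χ []|intros χ []].
    - destruct IH as (Δ & H1 & H2); [intros; apply HΓ; now right|].
      destruct (HΓ χ) as [H|[H| ->]]; [now left|..].
      + exists (χ :: Δ); split; [intros ? [<-|]; auto|].
        intros x [<-|Hx]; [right; now left|destruct (H2 x Hx) as [<-|]; [now left|right; now right]].
      + exists (χ :: Δ); split; [intros ? [<-|]; auto|].
        intros x [<-|Hx]; [right; now left|destruct (H2 x Hx) as [<-|]; [now left|right; now right]].
      + exists Δ; split; [exact H1|intros x [<-|Hx]; [now left|auto]]. }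
  destruct E as (Δ & H1 & H2); exists Δ; split; [exact H1|].
  apply D_impI; eapply derives_weaken; eauto.
Qed.

Lemma bound_fresh (L : list (form U)) φ : In φ L -> bound φ <= fresh L.
Proof.
  intros H; unfold fresh.
  pose proof (proj1 (list_max_le (map (@bound U) L) _) (le_n _)) as F.
  rewrite Forall_forall in F; apply F, in_map, H.
Qed.

(** A refutation of the instance at the fresh variable [c] can be generalized over [c], and then
    refutes the existential formula itself. *)
Lemma con_witness L φ : con (φ :: L) -> con (witness L φ ++ φ :: L).
Proof.
  intros HC; destruct φ; try exact HC.
  simpl witness; set (c := fresh (Ex φ :: L)); intros HP.
  apply HC.
  assert (HP' : provable (fun ψ => In ψ (Ex φ :: L)) (Imp (ren (inst c) φ) Bot)).
  { apply provable_imp; revert HP; apply provable_mono.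
    intros ψ [H|H]; [right; auto|left; exact H]. }
  destruct HP' as (Γ & HΓ & D).
  assert (HB : forall ψ, In ψ Γ -> bound ψ <= c).
  { intros ψ Hψ; destruct (HΓ ψ Hψ) as [H|H].
    - rewrite (T_closed H); lia.
    - now apply bound_fresh. }
  assert (Hc : bound (Ex φ) <= c) by (apply bound_fresh; now left).
  (* This renaming turns [c] into the bound variable 0 and shifts the rest. All variables of [Γ] lie
     below [c], so it acts on [Γ] as [S] and sends the instance back to [φ], the shape that [D_exE]
     expects. *)
  set (r k := if Nat.eq_dec k c then 0 else S k).
  apply derives_ren with (r := r) in D.
  replace (map (ren r) Γ) with (map (ren S) Γ) in D.
  2:{ apply map_ext_in; intros ψ Hψ; apply ren_bounded; intros k Hk.
      specialize (HB ψ Hψ); unfold r; destruct Nat.eq_dec; lia. }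
  simpl in D; replace (ren r (ren (inst c) φ)) with φ in D.
  2:{ rewrite ren_ren; rewrite <- (@ren_id _ φ (fun k => k)) at 1 by reflexivity.
      apply ren_bounded; intros [|k] Hk; unfold r.
      - change (inst c 0) with c; destruct Nat.eq_dec; lia.
      - rewrite inst_S; simpl in Hc; destruct Nat.eq_dec; lia. }
  exists (Ex φ :: Γ); split; [intros ψ [<-|H]; [right; now left|auto]|].
  apply D_exE with φ; [apply D_hyp; now left|].
  simpl; apply D_impE with φ; [|apply D_hyp; now left].
  eapply derives_weaken; [exact D|intros x Hx; simpl; auto].
Qed.

Lemma con_stage n : con (stage n).
Proof.
  induction n; simpl.
  - intros (Γ & HΓ & D); apply T_con; exists Γ; split; [|exact D].
    intros φ Hφ; destruct (HΓ φ Hφ) as [|[]]; auto.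
  - destruct decode; [destruct excluded_middle_informative|]; auto using con_witness.
Qed.

Lemma stage_mono n m : n <= m -> incl (stage n) (stage m).
Proof.
  induction 1; [apply incl_refl|].
  apply incl_tran with (stage m); [assumption|]; simpl; intros x Hx.
  destruct decode; [destruct excluded_middle_informative|]; auto.
  apply in_or_app; right; now right.
Qed.

Lemma provable_limit φ : provable limit φ -> exists n, provable (fun ψ => In ψ (stage n)) φ.
Proof.
  intros (Γ & HΓ & D).
  assert (E : exists n, forall ψ, In ψ Γ -> T ψ \/ In ψ (stage n)).
  { clear D; induction Γ as [|χ Γ IH]; [exists 0; intros ψ []|].
    destruct IH as [n Hn]; [intros; apply HΓ; now right|].
    destruct (HΓ χ) as [H|[m Hm]]; [now left|..].
    - exists n; intros ψ [<-|]; auto.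
    - exists (n + m); intros ψ [<-|Hψ].
      + right; revert Hm; apply stage_mono; lia.
      + destruct (Hn ψ Hψ) as [|H]; [now left|right; revert H; apply stage_mono; lia]. }
  destruct E as [n Hn]; exists n, Γ; auto.
Qed.

Lemma limit_con : ~ provable limit Bot.
Proof. intros H; apply provable_limit in H; destruct H as [n H]; now apply (con_stage n). Qed.

Lemma limit_step φ : ~ provable limit (Imp φ Bot) ->
  exists n, In φ (stage (S n)) /\ incl (witness (stage n) φ) (stage (S n)).
Proof.
  intros H; exists (code φ); simpl; rewrite decode_code.
  destruct excluded_middle_informative as [|HC].
  - split; [apply in_or_app; right; now left|apply incl_appl, incl_refl].
  - apply NNPP in HC; destruct H.
    apply provable_imp; revert HC; apply provable_mono.
    intros ψ [<-|Hψ]; [now right|left; now exists (code φ)].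
Qed.

Lemma limit_complete φ : provable limit φ \/ provable limit (Imp φ Bot).
Proof.
  destruct (classic (provable limit (Imp φ Bot))) as [|H]; [now right|left].
  destruct (limit_step H) as (n & Hn & _); apply provable_hyp; left; now exists (S n).
Qed.

(** * The limit theory commutes with the connectives and quantifiers *)

Ltac from l := apply (@provable_cut limit l); [simpl; intuition (subst; eauto)|].
Ltac hyp := solve [apply D_hyp; simpl; auto 8].

Lemma limit_neg φ : provable limit (Imp φ Bot) <-> ~ provable limit φ.
Proof.
  split.
  - intros H1 H2; apply limit_con; from [Imp φ Bot; φ]; apply D_impE with φ; hyp.
  - intros H; destruct (limit_complete φ); tauto.
Qed.

Lemma limit_imp φ ψ : provable limit (Imp φ ψ) <-> (provable limit φ -> provable limit ψ).
Proof.
  split.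
  - intros H1 H2; from [Imp φ ψ; φ]; apply D_impE with φ; hyp.
  - intros H; destruct (limit_complete φ) as [H1|H1].
    + from [ψ]; apply D_impI; hyp.
    + from [Imp φ Bot]; apply D_impI, D_raa, D_impE with φ; hyp.
Qed.

Lemma limit_and φ ψ : provable limit (And φ ψ) <-> provable limit φ /\ provable limit ψ.
Proof.
  split.
  - intros H; split; from [And φ ψ]; [apply D_andE1 with ψ|apply D_andE2 with φ]; hyp.
  - intros [H1 H2]; from [φ; ψ]; apply D_andI; hyp.
Qed.

Lemma limit_or φ ψ : provable limit (Or φ ψ) <-> provable limit φ \/ provable limit ψ.
Proof.
  split.
  - intros H; destruct (limit_complete φ) as [|H1]; [now left|right].
    from [Or φ ψ; Imp φ Bot]; apply D_orE with φ ψ; try hyp.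
    apply D_raa, D_impE with φ; hyp.
  - intros [H|H]; [from [φ]; apply D_orI1|from [ψ]; apply D_orI2]; hyp.
Qed.

Lemma limit_ex φ : provable limit (Ex φ) <-> exists t, provable limit (ren (inst t) φ).
Proof.
  split.
  - intros H; destruct (@limit_step (Ex φ)) as (n & _ & Hn).
    { rewrite limit_neg; tauto. }
    eexists; apply provable_hyp; left; exists (S n); apply Hn; now left.
  - intros [t H]; from [ren (inst t) φ]; apply D_exI with t; hyp.
Qed.

Lemma limit_all φ : provable limit (All φ) <-> forall t, provable limit (ren (inst t) φ).
Proof.
  split.
  - intros H t; from [All φ]; apply D_allE; hyp.
  - intros H; destruct (limit_complete (Ex (Imp φ Bot))) as [H1|H1].
    + apply limit_ex in H1; destruct H1 as [t H1].
      simpl in H1; apply limit_neg in H1; destruct H1; apply H.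
    + from [Imp (Ex (Imp φ Bot)) Bot]; apply D_allI, D_raa.
      simpl; apply D_impE with (ren S (Ex (Imp φ Bot))); [hyp|].
      apply D_exI with 0.
      change (derives [Imp φ Bot; ren S (Imp (Ex (Imp φ Bot)) Bot)]
                (Imp (ren (inst 0) (ren (up S) φ)) Bot)).
      replace (ren (inst 0) (ren (up S) φ)) with φ; [hyp|].
      rewrite ren_ren; symmetry; apply ren_id; intros [|k]; simpl; [reflexivity|apply inst_S].
Qed.

(** * The term model *)

Lemma limit_eq_subst φ x y :
  provable limit (Eq x y) -> provable limit (ren (inst x) φ) -> provable limit (ren (inst y) φ).
Proof.
  intros H1 H2; from [Eq x y; ren (inst x) φ]; apply D_eqE with x; hyp.
Qed.

Lemma limit_eq_refl x : provable limit (Eq x x).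
Proof. from (@nil (form U)); apply D_eqI. Qed.

(** [Eq] is interpreted by genuine equality, so variables are replaced by their classes under
    provable equality. As predicates, classes with the same members are identical by
    extensionality. *)
Definition class (x : nat) : nat -> Prop := fun y => provable limit (Eq x y).

Lemma class_eq x y : class x = class y <-> provable limit (Eq x y).
Proof.
  split; intros H.
  - change (class x y); rewrite H; apply limit_eq_refl.
  - assert (H' : provable limit (Eq y x)).
    { pose proof (limit_eq_subst (Eq 0 (S x)) H) as P; cbn [ren] in P; rewrite !inst_S in P.
      apply P, limit_eq_refl. }
    apply functional_extensionality; intro z; apply propositional_extensionality; split.
    + pose proof (limit_eq_subst (Eq 0 (S z)) H) as P; cbn [ren] in P; now rewrite !inst_S in P.
    + pose proof (limit_eq_subst (Eq 0 (S z)) H') as P; cbn [ren] in P; now rewrite !inst_S in P.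
Qed.

Definition henkin : structure U := {|
  dom := {C : nat -> Prop | exists x, class x = C};
  dom_inhabited := inhabits (exist _ (class 0) (ex_intro _ 0 eq_refl));
  pred u C := exists x, class x = proj1_sig C /\ provable limit (Pred u x);
  mem C D := exists x y, class x = proj1_sig C /\ class y = proj1_sig D
                         /\ provable limit (Mem x y)
|}.

Definition cl (x : nat) : henkin := exist _ (class x) (ex_intro _ x eq_refl).

Lemma cl_eq x y : cl x = cl y <-> provable limit (Eq x y).
Proof.
  rewrite <- class_eq; split; intros H; [now injection H|].
  apply subset_eq_compat, H.
Qed.

(** Every element is the class of a variable, so a quantifier extends [r] by an arbitrary variable
    [t]; instantiating after [up r] is renaming along [scons t r], to which the induction hypothesis
    applies. *)
Lemma henkin_truth φ : forall r,
  sat henkin (fun k => cl (r k)) φ <-> provable limit (ren r φ).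
Proof.
  assert (Hs : forall t r k, scons (cl t) (fun k => cl (r k)) k = cl (scons t r k))
    by (intros t r [|k]; reflexivity).
  assert (Hs' := fun t r k => eq_sym (Hs t r k)).
  assert (Hi : forall t r φ, ren (inst t) (ren (up r) φ) = ren (scons t r) φ).
  { intros; rewrite ren_ren; apply ren_ext; intros [|k]; simpl; [reflexivity|apply inst_S]. }
  induction φ; simpl; intros r.
  - split.
    + intros (x & H & P); apply class_eq in H.
      apply (limit_eq_subst (Pred u 0) H P).
    + intros H; exists (r n); auto.
  - split.
    + intros (x & y & H1 & H2 & P); apply class_eq in H1, H2.
      pose proof (limit_eq_subst (Mem 0 (S y)) H1) as P1; cbn [ren] in P1.
      pose proof (limit_eq_subst (Mem (S (r n)) 0) H2) as P2; cbn [ren] in P2.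
      rewrite !inst_S in P1, P2; auto.
    + intros H; exists (r n), (r n0); auto.
  - apply cl_eq.
  - split; [tauto|apply limit_con].
  - now rewrite IHφ1, IHφ2, limit_imp.
  - now rewrite IHφ1, IHφ2, limit_and.
  - now rewrite IHφ1, IHφ2, limit_or.
  - rewrite limit_all; split.
    + intros H t; rewrite Hi, <- IHφ; specialize (H (cl t)); revert H; apply sat_ext.
      intro; auto.
    + intros H [C [t Ht]].
      assert (E : exist _ C (ex_intro _ t Ht) = cl t) by (apply subset_eq_compat; auto).
      rewrite E; specialize (H t); rewrite Hi, <- IHφ in H; revert H; apply sat_ext.
      intro; auto.
  - rewrite limit_ex; split.
    + intros [[C [t Ht]] H]; exists t.
      assert (E : exist _ C (ex_intro _ t Ht) = cl t) by (apply subset_eq_compat; auto).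
      rewrite E in H; rewrite Hi, <- IHφ; revert H; apply sat_ext.
      intro; auto.
    + intros [t H]; exists (cl t); rewrite Hi, <- IHφ in H; revert H; apply sat_ext.
      intro; auto.
Qed.

Lemma completeness : exists M : structure U, models M T.
Proof.
  exists henkin; intros φ Tφ e.
  apply (@sat_bounded _ henkin φ e (fun k => cl k)); [rewrite (T_closed Tφ); intros; lia|].
  apply (henkin_truth φ (fun k => k)), provable_hyp; right.
  now rewrite ren_id.
Qed.

End Completeness.

(** * Coding of formulas, and a model of ZF *)

Fixpoint form_code {U} (f : U -> nat) (φ : form U) : nat :=
  match φ with
  | Pred u x => to_nat (0, to_nat (f u, x))
  | Mem x y => to_nat (1, to_nat (x, y))
  | Eq x y => to_nat (2, to_nat (x, y))
  | Bot => to_nat (3, 0)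
  | Imp φ ψ => to_nat (4, to_nat (form_code f φ, form_code f ψ))
  | And φ ψ => to_nat (5, to_nat (form_code f φ, form_code f ψ))
  | Or φ ψ => to_nat (6, to_nat (form_code f φ, form_code f ψ))
  | All φ => to_nat (7, form_code f φ)
  | Ex φ => to_nat (8, form_code f φ)
  end.

Lemma form_code_inj {U} (f : U -> nat) : (forall u v, f u = f v -> u = v) ->
  forall φ ψ, form_code f φ = form_code f ψ -> φ = ψ.
Proof.
  intros Hf; induction φ; intros ψ H; destruct ψ; cbn [form_code] in H; apply to_nat_inj in H;
    try discriminate H; try reflexivity;
    apply pair_equal_spec in H; destruct H as [_ H];
    try (apply to_nat_inj, pair_equal_spec in H; destruct H as [H H']); f_equal; auto.
Qed.

Lemma ZF_closed φ : ZF φ -> bound φ = 0.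
Proof. intros []; try reflexivity; apply bound_close. Qed.

Lemma ZF_model : consistent ZF -> exists V : structure Empty_set, models V ZF.
Proof.
  intros H; eapply completeness; [|apply ZF_closed|exact H].
  apply (form_code_inj (fun u : Empty_set => match u with end)); intros [].
Qed.

(** * Definability with parameters *)

Section Definability.
Context {U : Type} {V : structure U}.
Implicit Types (e : nat -> V) (P Q : (nat -> V) -> Prop).

Definition look e (i : nat + V) : V := match i with inl k => e k | inr a => a end.

(* First-order definability with parameters: [ρ] says which free variables of φ
   are variables of P and which are parameters. *)
Definition Def P : Prop :=
  exists φ (ρ : nat -> nat + V), forall e, P e <-> sat V (fun k => look e (ρ k)) φ.

Definition DefFun (f : (nat -> V) -> V) : Prop :=
  Def (fun e => e 0 = f (fun k => e (S k))).

Lemma def_iff_mono P Q : (forall e, P e <-> Q e) -> Def P -> Def Q.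
Proof. intros H (φ & ρ & D); exists φ, ρ; intro e; now rewrite <- H. Qed.

Lemma def_comp P (ρ : nat -> nat + V) : Def P -> Def (fun e => P (fun k => look e (ρ k))).
Proof.
  intros (φ & σ & D).
  exists φ, (fun k => match σ k with inl j => ρ j | inr a => inr a end).
  intro e; rewrite D; apply sat_ext; intro k; destruct (σ k); reflexivity.
Qed.

(** Merges the assignments of two formulas into one: the variables of the first formula become even,
    those of the second odd. *)
Definition mix {X : Type} (f g : nat -> X) (k : nat) : X :=
  if Nat.even k then f (k / 2) else g (k / 2).

Lemma mix_even {X} (f g : nat -> X) k : mix f g (2 * k) = f k.
Proof.
  unfold mix; rewrite Nat.even_even, Nat.mul_comm, Nat.div_mul; auto.
Qed.

Lemma mix_odd {X} (f g : nat -> X) k : mix f g (2 * k + 1) = g k.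
Proof.
  unfold mix; rewrite Nat.even_odd, Nat.mul_comm, Nat.div_add_l, Nat.add_0_r; auto.
Qed.

Lemma def_binary (c : form U -> form U -> form U) (C : Prop -> Prop -> Prop) P Q :
  (forall e φ ψ, sat V e (c φ ψ) <-> C (sat V e φ) (sat V e ψ)) ->
  Def P -> Def Q -> Def (fun e => C (P e) (Q e)).
Proof.
  intros HC (φ & ρ & D) (ψ & σ & E).
  exists (c (ren (fun k => 2 * k) φ) (ren (fun k => 2 * k + 1) ψ)), (mix ρ σ).
  intro e; rewrite HC.
  replace (sat V _ (ren _ φ)) with (P e).
  2:{ apply propositional_extensionality; rewrite D, sat_ren; apply sat_ext; intro.
      now rewrite mix_even. }
  replace (sat V _ (ren _ ψ)) with (Q e); [reflexivity|].
  apply propositional_extensionality; rewrite E, sat_ren; apply sat_ext; intro.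
  now rewrite mix_odd.
Qed.

Lemma def_and P Q : Def P -> Def Q -> Def (fun e => P e /\ Q e).
Proof. apply (def_binary (@And U) and); reflexivity. Qed.

Lemma def_or P Q : Def P -> Def Q -> Def (fun e => P e \/ Q e).
Proof. apply (def_binary (@Or U) or); reflexivity. Qed.

Lemma def_imp P Q : Def P -> Def Q -> Def (fun e => P e -> Q e).
Proof. apply (def_binary (@Imp U) (fun A B => A -> B)); reflexivity. Qed.

Lemma def_const (A : Prop) : Def (fun _ => A).
Proof.
  destruct (classic A).
  - exists (Imp Bot Bot), inl; simpl; tauto.
  - exists Bot, inl; simpl; tauto.
Qed.

Lemma def_not P : Def P -> Def (fun e => ~ P e).
Proof. intros D; apply (def_imp D), def_const. Qed.

Lemma def_iff P Q : Def P -> Def Q -> Def (fun e => P e <-> Q e).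
Proof. intros; apply def_and; apply def_imp; auto. Qed.

Lemma def_ex (P : (nat -> V) -> V -> Prop) :
  Def (fun e => P (fun k => e (S k)) (e 0)) -> Def (fun e => exists a, P e a).
Proof.
  intros (φ & ρ & D).
  (* Several variables of [φ] may stand for [e 0]; all of them become the newly bound variable.
     After that [ρ'] is never consulted at these positions, so its value there is arbitrary. *)
  set (r k := match ρ k with inl 0 => 0 | _ => S k end).
  set (ρ' k := match ρ k with inl (S j) => inl j | inr a => inr a | inl 0 => inl 0 end).
  exists (Ex (ren r φ)), ρ'; intro e; simpl.
  assert (H : forall a, P e a <-> sat V (scons a (fun k => look e (ρ' k))) (ren r φ)).
  { intro a; rewrite sat_ren, (D (scons a e)); apply sat_ext; intro k; unfold r, ρ'.
    destruct (ρ k) as [[|j]|b] eqn:E; simpl; try rewrite E; reflexivity. }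
  split; intros [a Ha]; exists a; now apply H.
Qed.

Lemma def_all (P : (nat -> V) -> V -> Prop) :
  Def (fun e => P (fun k => e (S k)) (e 0)) -> Def (fun e => forall a, P e a).
Proof.
  intros D; apply def_iff_mono with (fun e => ~ exists a, ~ P e a).
  - intro e; split; [|intros H [a Ha]; auto].
    intros H a; apply NNPP; eauto.
  - now apply def_not, def_ex, def_not.
Qed.

Lemma def_shift (f : (nat -> V) -> V) : DefFun f -> DefFun (fun e => f (fun k => e (S k))).
Proof.
  intros D; apply (def_comp (fun k => match k with 0 => inl 0 | S k => inl (S (S k)) end) D).
Qed.

Lemma deffun_var n : DefFun (fun e => e n).
Proof.
  exists (Eq 0 1), (fun k => match k with 0 => inl 0 | _ => inl (S n) end); reflexivity.
Qed.

Lemma deffun_const a : DefFun (fun _ => a).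
Proof.
  exists (Eq 0 1), (fun k => match k with 0 => inl 0 | _ => inr a end); reflexivity.
Qed.

(** Function terms are eliminated by quantifying over their value. *)
Lemma def_subst (Q : (nat -> V) -> V -> Prop) f : DefFun f ->
  Def (fun e => Q (fun k => e (S k)) (e 0)) -> Def (fun e => Q e (f e)).
Proof.
  intros D E; apply def_iff_mono with (fun e => exists y, y = f e /\ Q e y).
  - intro e; split; [now intros (y & -> & H)|eauto].
  - now apply def_ex, def_and.
Qed.

Lemma def_rel1 (R : V -> Prop) f : Def (fun e => R (e 0)) -> DefFun f -> Def (fun e => R (f e)).
Proof.
  intros D Df; apply (def_subst (fun _ y => R y) Df D).
Qed.

Lemma def_rel2 (R : V -> V -> Prop) f g :
  Def (fun e => R (e 0) (e 1)) -> DefFun f -> DefFun g -> Def (fun e => R (f e) (g e)).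
Proof.
  intros D Df Dg; apply (def_subst (fun e y => R y (g e)) Df).
  apply (def_subst (fun e y => R (e 0) y) (def_shift Dg)).
  apply (def_comp (fun k => match k with 0 => inl 1 | _ => inl 0 end) D).
Qed.

Lemma def_rel3 (R : V -> V -> V -> Prop) f g h :
  Def (fun e => R (e 0) (e 1) (e 2)) -> DefFun f -> DefFun g -> DefFun h ->
  Def (fun e => R (f e) (g e) (h e)).
Proof.
  intros D Df Dg Dh; apply (def_subst (fun e y => R y (g e) (h e)) Df).
  apply (def_subst (fun e y => R (e 0) y (h (fun k => e (S k)))) (def_shift Dg)).
  apply (def_subst (fun e y => R (e 1) (e 0) y) (def_shift (def_shift Dh))).
  apply (def_comp (fun k => match k with 0 => inl 2 | 1 => inl 1 | _ => inl 0 end) D).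
Qed.

Lemma def_mem f g : DefFun f -> DefFun g -> Def (fun e => mem V (f e) (g e)).
Proof.
  apply def_rel2; exists (Mem 0 1), inl; reflexivity.
Qed.

Lemma def_eq f g : DefFun f -> DefFun g -> Def (fun e => f e = g e).
Proof.
  apply def_rel2; exists (Eq 0 1), inl; reflexivity.
Qed.

Lemma deffun_intro (f : (nat -> V) -> V) (R : (nat -> V) -> V -> Prop) :
  (forall e y, R e y <-> y = f e) -> Def (fun e => R (fun k => e (S k)) (e 0)) -> DefFun f.
Proof. intros H; apply def_iff_mono; intro e; apply H. Qed.

Lemma deffun1 (F : V -> V) f : Def (fun e => e 0 = F (e 1)) -> DefFun f -> DefFun (fun e => F (f e)).
Proof.
  intros D Df; apply (def_rel2 (fun a b => a = F b) D);
  [apply deffun_var|apply def_shift, Df].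
Qed.

Lemma deffun2 (F : V -> V -> V) f g : Def (fun e => e 0 = F (e 1) (e 2)) ->
  DefFun f -> DefFun g -> DefFun (fun e => F (f e) (g e)).
Proof.
  intros D Df Dg; apply (def_rel3 (fun a b c => a = F b c) D);
  [apply deffun_var|apply def_shift, Df|apply def_shift, Dg].
Qed.

(** Brings a definition into the shape of the axiom schemes: the arguments are the variables 0 and
    1, and the parameters follow. *)
Lemma def_formula2 (R : V -> V -> Prop) : Def (fun e => R (e 0) (e 1)) ->
  exists φ p, forall x y, R x y <-> sat V (scons x (scons y p)) φ.
Proof.
  intros (φ & ρ & D); destruct (dom_inhabited V) as [d].
  exists (ren (fun k => match ρ k with inl 0 => 0 | inl (S _) => 1 | inr _ => S (S k) end) φ),
    (fun k => match ρ k with inr a => a | _ => d end).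
  intros x y; rewrite sat_ren, (D (scons x (scons y (fun _ => y)))).
  apply sat_ext; intro k; destruct (ρ k) as [[|[|j]]|a] eqn:E; simpl; try reflexivity.
  now rewrite E.
Qed.

Lemma def_formula1 (P : V -> Prop) : Def (fun e => P (e 0)) ->
  exists φ p, forall x, P x <-> sat V (scons x p) φ.
Proof.
  intros D; destruct (@def_formula2 (fun x _ => P x) D) as (φ & p & H).
  exists φ, (scons (p 0) p); auto.
Qed.

End Definability.

(* [DefFun] unfolds to [Def], so the two kinds of goals are separated by matching. *)
Ltac def_fun_extra := fail.
Ltac def_rel_extra := fail.
Ltac def_step :=
  cbv beta;
  lazymatch goal with
  | |- DefFun _ => first [assumption | apply deffun_var | apply deffun_const | def_fun_extra]
  | |- Def _ =>
    first
    [ assumption | apply def_const | def_rel_extra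
    | lazymatch goal with
      | |- Def (fun e => @?P e /\ @?Q e) => apply (@def_and _ _ P Q)
      | |- Def (fun e => @?P e \/ @?Q e) => apply (@def_or _ _ P Q)
      | |- Def (fun e => @?P e <-> @?Q e) => apply (@def_iff _ _ P Q)
      | |- Def (fun e => ~ @?P e) => apply (@def_not _ _ P)
      | |- Def (fun e => @?P e -> @?Q e) => apply (@def_imp _ _ P Q)
      | |- Def (fun e => exists a, @?P e a) => apply (@def_ex _ _ P)
      | |- Def (fun e => forall a, @?P e a) => apply (@def_all _ _ P)
      | |- Def (fun e => mem _ (@?f e) (@?g e)) => apply (@def_mem _ _ f g)
      | |- Def (fun e => @?f e = @?g e) => apply (@def_eq _ _ f g)
      end ]
  end.
Ltac def := repeat def_step.

(** * Basic set theory in a model of ZF *)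

Declare Scope zf_scope.
Notation "x ∊ y" := (mem _ x y) (at level 70) : zf_scope.

Section BasicSetTheory.
Local Open Scope zf_scope.
Context {V : structure Empty_set} (HV : models V ZF).
Implicit Types (x y z a b w s : V).

Lemma set_ext a b : (forall z, z ∊ a <-> z ∊ b) -> a = b.
Proof.
  intros H; pose proof (HV (ZF_extensionality _) (fun _ => a) b a) as E; simpl in E.
  apply E; split; [tauto|split; [tauto|]]; intro c; split; apply H.
Qed.

Lemma set_foundation a : (exists b, b ∊ a) -> exists b, b ∊ a /\ forall c, c ∊ b -> ~ c ∊ a.
Proof.
  intros H; pose proof (HV (ZF_foundation _) (fun _ => a) a) as E; simpl in E.
  destruct (E H) as (b & H1 & H2); exists b; split; [exact H1|]; eauto.
Qed.

Lemma separation_def (P : V -> Prop) w : Def (fun e => P (e 0)) ->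
  exists s, forall z, z ∊ s <-> z ∊ w /\ P z.
Proof.
  intros D; destruct (def_formula1 _ D) as (φ & p & H).
  pose proof (HV (ZF_separation _ φ)) as E; unfold separation in E; rewrite holds_close in E.
  specialize (E p w); destruct E as (s & _ & E); exists s; intro z.
  specialize (E z); simpl in E; rewrite sat_ren in E; rewrite H.
  rewrite (sat_ext V φ (scons z p) (fun k => scons z (scons s (scons w p)) (args [0] 3 k))); [tauto|].
  intros [|[|k]]; reflexivity.
Qed.

Lemma replacement_def (R : V -> V -> Prop) w : Def (fun e => R (e 0) (e 1)) ->
  (forall x, x ∊ w -> exists y, forall y', R x y' <-> y' = y) ->
  exists v, forall y, y ∊ v <-> exists x, x ∊ w /\ R x y.
Proof.
  intros D HR; destruct (def_formula2 _ D) as (φ & p & H).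
  pose proof (HV (ZF_replacement _ φ)) as E; unfold replacement in E; rewrite holds_close in E.
  specialize (E p w); simpl in E.
  destruct E as [v Hv].
  - intros x Hx; destruct (HR x Hx) as [y Hy]; exists y; intro y'.
    specialize (Hy y'); rewrite H in Hy; rewrite sat_ren.
    rewrite (sat_ext V φ _ (scons x (scons y' p))); [tauto|].
    intros [|[|[|k]]]; reflexivity.
  (* The axiom only provides a set that contains all values; separation makes it exact. *)
  - destruct (@separation_def (fun y => exists x, x ∊ w /\ R x y) v) as [s Hs].
    { def. }
    exists s; intro y; rewrite Hs; split; [tauto|]; intros H'; split; [|exact H'].
    destruct H' as (x & Hx & Hxy).
    destruct (Hv x Hx) as (y' & Hy' & Hs'); rewrite sat_ren in Hs'.
    assert (R x y').
    { rewrite H; revert Hs'; apply sat_ext; intros [|[|[|k]]]; reflexivity. }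
    destruct (HR x Hx) as [y0 Hy0]; apply Hy0 in H0, Hxy; congruence.
Qed.

Lemma foundation_def (P : V -> Prop) w : Def (fun e => P (e 0)) -> (exists x, x ∊ w /\ P x) ->
  exists x, x ∊ w /\ P x /\ forall y, y ∊ x -> y ∊ w -> ~ P y.
Proof.
  intros D (x & Hx & HP); destruct (@separation_def P w D) as [s Hs].
  destruct (@set_foundation s) as (b & Hb & Hmin); [exists x; apply Hs; auto|].
  apply Hs in Hb; exists b; split; [tauto|split; [tauto|]].
  intros y Hy Hw HPy; apply (Hmin y Hy), Hs; auto.
Qed.

(** A term for a set given by its members. Extensionality makes the choice unique when [small P]
    holds, and this is what lets [deffun_setof] recover a first-order definition. *)
Definition setof (P : V -> Prop) : V :=
  epsilon (dom_inhabited V) (fun s => forall z, z ∊ s <-> P z).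

Definition small (P : V -> Prop) : Prop := exists s, forall z, z ∊ s <-> P z.

Lemma mem_setof P z : small P -> z ∊ setof P <-> P z.
Proof.
  intros H; exact (epsilon_spec (dom_inhabited V) _ H z).
Qed.

Lemma deffun_setof (P : (nat -> V) -> V -> Prop) :
  (forall e, small (P e)) -> Def (fun e => P (fun k => e (S k)) (e 0)) ->
  DefFun (fun e => setof (P e)).
Proof.
  intros HP D; apply deffun_intro with (fun e s => forall z, z ∊ s <-> P e z).
  - intros e y; split; [|intros ->; intro; now apply mem_setof].
    intros H; apply set_ext; intro z; now rewrite mem_setof.
  - def; apply (def_comp (fun k => match k with 0 => inl 0 | S k => inl (S (S k)) end) D).
Qed.

Lemma small_sub P w : Def (fun e => P (e 0)) -> (forall z, P z -> z ∊ w) -> small P.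
Proof.
  intros D H; destruct (@separation_def P w D) as [s Hs]; exists s; intro z; rewrite Hs.
  split; [tauto|auto].
Qed.

(** * Elementary set operations *)

Definition empty : V := setof (fun _ => False).
Definition pairset a b : V := setof (fun z => z = a \/ z = b).
Definition sing a : V := pairset a a.
Definition op a b : V := pairset (sing a) (pairset a b).
Definition bigunion a : V := setof (fun z => exists y, y ∊ a /\ z ∊ y).
Definition bunion a b : V := bigunion (pairset a b).
Definition power a : V := setof (fun z => forall y, y ∊ z -> y ∊ a).
Definition suc a : V := bunion a (sing a).
Definition image (f : V -> V) w : V := setof (fun y => exists x, x ∊ w /\ y = f x).

Lemma small_pairset a b : small (fun z => z = a \/ z = b).
Proof.
  destruct (HV (ZF_pairing _) (fun _ => a) b a) as (s & _ & H).
  exists s; intro z; apply (H z).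
Qed.

Lemma small_union a : small (fun z => exists y, y ∊ a /\ z ∊ y).
Proof.
  destruct (HV (ZF_union _) (fun _ => a) a) as (s & _ & H).
  exists s; intro z; apply (H z).
Qed.

Lemma small_power a : small (fun z => forall y, y ∊ z -> y ∊ a).
Proof.
  destruct (HV (ZF_powerset _) (fun _ => a) a) as (s & _ & H).
  exists s; intro z; specialize (H z); simpl in H; split; [apply H|].
  intros; apply H; auto.
Qed.

Lemma mem_empty z : ~ z ∊ empty.
Proof.
  unfold empty; rewrite mem_setof; [tauto|].
  apply small_sub with z; [def|tauto].
Qed.

Lemma mem_pairset a b z : z ∊ pairset a b <-> z = a \/ z = b.
Proof. apply mem_setof, small_pairset. Qed.

Lemma mem_sing a z : z ∊ sing a <-> z = a.
Proof. unfold sing; rewrite mem_pairset; tauto. Qed.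

Lemma mem_bigunion a z : z ∊ bigunion a <-> exists y, y ∊ a /\ z ∊ y.
Proof. apply mem_setof, small_union. Qed.

Lemma mem_bunion a b z : z ∊ bunion a b <-> z ∊ a \/ z ∊ b.
Proof.
  unfold bunion; rewrite mem_bigunion; setoid_rewrite mem_pairset; firstorder (subst; auto).
Qed.

Lemma mem_power a z : z ∊ power a <-> forall y, y ∊ z -> y ∊ a.
Proof. apply mem_setof, small_power. Qed.

Lemma mem_suc a z : z ∊ suc a <-> z ∊ a \/ z = a.
Proof. unfold suc; now rewrite mem_bunion, mem_sing. Qed.

Lemma small_image f w : Def (fun e => e 0 = f (e 1)) -> small (fun y => exists x, x ∊ w /\ y = f x).
Proof.
  intros D; apply replacement_def.
  - apply (def_comp (fun k => match k with 0 => inl 1 | _ => inl 0 end) D).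
  - intros x Hx; exists (f x); tauto.
Qed.

Lemma mem_image f w y : Def (fun e => e 0 = f (e 1)) ->
  y ∊ image f w <-> exists x, x ∊ w /\ y = f x.
Proof. intros; apply mem_setof, small_image; auto. Qed.

Lemma nonempty a : a <> empty -> exists x, x ∊ a.
Proof.
  intros H; apply NNPP; intros H'; apply H, set_ext; intro z.
  split; [intros; destruct H'; eauto|now intros ?%mem_empty].
Qed.

Lemma eq_empty a : (forall x, ~ x ∊ a) -> a = empty.
Proof. intros H; apply NNPP; intros []%nonempty; firstorder. Qed.

Lemma pairset_inj1 a b c : pairset a b = pairset a c -> b = c.
Proof.
  intros H.
  assert (Hb : b ∊ pairset a c) by (rewrite <- H; apply mem_pairset; auto).
  assert (Hc : c ∊ pairset a b) by (rewrite H; apply mem_pairset; auto).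
  apply mem_pairset in Hb, Hc; intuition congruence.
Qed.

Lemma sing_inj a b : sing a = sing b -> a = b.
Proof. intros H; apply mem_sing; rewrite <- H; now apply mem_sing. Qed.

Lemma op_inj a b c d : op a b = op c d -> a = c /\ b = d.
Proof.
  unfold op; intros H.
  assert (E : a = c).
  { assert (H1 : sing a ∊ pairset (sing c) (pairset c d)) by (rewrite <- H; apply mem_pairset; auto).
    apply mem_pairset in H1; destruct H1 as [H1|H1]; [now apply sing_inj|].
    symmetry; apply mem_sing; rewrite H1; apply mem_pairset; auto. }
  subst c; split; [reflexivity|].
  apply pairset_inj1 in H; now apply pairset_inj1 in H.
Qed.

Lemma no_loop a : ~ a ∊ a.
Proof.
  intros H; destruct (@set_foundation (sing a)) as (b & Hb & Hm).
  - exists a; now apply mem_sing.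
  - apply mem_sing in Hb; subst b; apply (Hm a H); now apply mem_sing.
Qed.

Lemma no_loop2 a b : a ∊ b -> ~ b ∊ a.
Proof.
  intros H1 H2; destruct (@set_foundation (pairset a b)) as (c & Hc & Hm).
  - exists a; apply mem_pairset; auto.
  - apply mem_pairset in Hc; destruct Hc; subst c.
    + apply (Hm b H2), mem_pairset; auto.
    + apply (Hm a H1), mem_pairset; auto.
Qed.

Lemma deffun_pairset f g : DefFun f -> DefFun g -> DefFun (fun e => pairset (f e) (g e)).
Proof.
  apply deffun2; apply (@deffun_setof (fun e z => z = e 0 \/ z = e 1));
    [intro; apply small_pairset|def].
Qed.

Lemma deffun_sing f : DefFun f -> DefFun (fun e => sing (f e)).
Proof. intros; now apply deffun_pairset. Qed.

Lemma deffun_op f g : DefFun f -> DefFun g -> DefFun (fun e => op (f e) (g e)).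
Proof. intros; unfold op; repeat apply deffun_pairset; auto. Qed.

Lemma deffun_bigunion f : DefFun f -> DefFun (fun e => bigunion (f e)).
Proof.
  apply deffun1; apply (@deffun_setof (fun e z => exists y, y ∊ e 0 /\ z ∊ y));
    [intro; apply small_union|def].
Qed.

Lemma deffun_bunion f g : DefFun f -> DefFun g -> DefFun (fun e => bunion (f e) (g e)).
Proof. intros; now apply deffun_bigunion, deffun_pairset. Qed.

Lemma deffun_suc f : DefFun f -> DefFun (fun e => suc (f e)).
Proof. intros; apply deffun_bunion; [|apply deffun_sing]; auto. Qed.

(** ** The natural numbers *)

Definition inductive_set s : Prop := empty ∊ s /\ forall x, x ∊ s -> suc x ∊ s.

Definition ω : V := setof (fun n => forall s, inductive_set s -> n ∊ s).

Lemma inductive_set_exists : exists s, inductive_set s.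
Proof.
  destruct (HV (ZF_infinity _) (fun _ => empty)) as (s & _ & (z & Hz & _ & Hz') & H).
  exists s; split.
  - replace empty with z; [exact Hz|]; apply eq_empty; intros x Hx.
    apply (Hz' x Hx).
  - intros x Hx; destruct (H x Hx) as (y & Hy & _ & Hy').
    replace (suc x) with y; [exact Hy|]; apply set_ext; intro c.
    rewrite mem_suc; apply (Hy' c).
Qed.

Lemma def_inductive_set f : DefFun f -> Def (fun e => inductive_set (f e)).
Proof.
  apply def_rel1; unfold inductive_set; repeat first [apply deffun_suc | def_step].
Qed.

Lemma mem_ω n : n ∊ ω <-> forall s, inductive_set s -> n ∊ s.
Proof.
  apply mem_setof; destruct inductive_set_exists as [s Hs].
  apply small_sub with s; [|auto].
  def; apply def_inductive_set; def.
Qed.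

Lemma empty_ω : empty ∊ ω.
Proof. apply mem_ω; intros s H; apply H. Qed.

Lemma suc_ω n : n ∊ ω -> suc n ∊ ω.
Proof. rewrite !mem_ω; intros H s Hs; apply Hs; auto. Qed.

(** Nonstandard members of [ω] are beyond the reach of induction on [nat], so the predicate has to
    be definable in [V]. *)
Lemma ω_ind (P : V -> Prop) : Def (fun e => P (e 0)) -> P empty ->
  (forall n, n ∊ ω -> P n -> P (suc n)) -> forall n, n ∊ ω -> P n.
Proof.
  intros D H0 HS n Hn; destruct (@separation_def P ω D) as [s Hs].
  apply (Hs n); rewrite mem_ω in Hn; apply Hn; split.
  - apply Hs; split; [apply empty_ω|exact H0].
  - intros x Hx; apply Hs in Hx; apply Hs; split; [apply suc_ω|apply HS]; tauto.
Qed.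

Lemma ω_sub n x : n ∊ ω -> x ∊ n -> x ∊ ω.
Proof.
  intros Hn; revert x; revert n Hn; apply (ω_ind (fun n => forall x, x ∊ n -> x ∊ ω)); [def|..].
  - now intros x ?%mem_empty.
  - intros n Hn IH x [| ->]%mem_suc; auto.
Qed.

Lemma ω_trans n x y : n ∊ ω -> x ∊ n -> y ∊ x -> y ∊ n.
Proof.
  intros Hn; revert x y; revert n Hn.
  apply (ω_ind (fun n => forall x y, x ∊ n -> y ∊ x -> y ∊ n)); [def|..].
  - now intros x y ?%mem_empty.
  - intros n Hn IH x y Hx Hy; apply mem_suc in Hx as [Hx| ->]; apply mem_suc; eauto.
Qed.

Lemma ω_zero n : n ∊ ω -> n = empty \/ empty ∊ n.
Proof.
  revert n; apply (ω_ind (fun n => n = empty \/ empty ∊ n)); [def|auto|].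
  intros n Hn [->|H]; right; apply mem_suc; auto.
Qed.

Lemma ω_suc n x : n ∊ ω -> x ∊ n -> suc x ∊ n \/ suc x = n.
Proof.
  intros Hn; revert x; revert n Hn.
  apply (ω_ind (fun n => forall x, x ∊ n -> suc x ∊ n \/ suc x = n)); [repeat first [apply deffun_suc | def_step]|..].
  - now intros x ?%mem_empty.
  - intros n Hn IH x [H| <-]%mem_suc; [|auto].
    left; apply mem_suc; auto.
Qed.

Lemma ω_linear m n : m ∊ ω -> n ∊ ω -> m ∊ n \/ m = n \/ n ∊ m.
Proof.
  intros Hm Hn; revert m Hm.
  apply (ω_ind (fun m => m ∊ n \/ m = n \/ n ∊ m)); [def|..].
  - destruct (ω_zero _ Hn); auto.
  - intros m Hm [H|[<-|H]].
    + destruct (ω_suc _ _ Hn H); auto.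
    + right; right; apply mem_suc; auto.
    + right; right; apply mem_suc; auto.
Qed.

(** Used to replace two supports by a common one. *)
Lemma ω_directed m n : m ∊ ω -> n ∊ ω ->
  exists k, k ∊ ω /\ (forall x, x ∊ m -> x ∊ k) /\ (forall x, x ∊ n -> x ∊ k).
Proof.
  intros Hm Hn; destruct (ω_linear _ _ Hm Hn) as [H|[<-|H]].
  - exists n; split; [auto|split; [|auto]]; intros x; now apply ω_trans.
  - exists m; auto.
  - exists m; split; [auto|split; [auto|]]; intros x; now apply ω_trans.
Qed.

End BasicSetTheory.

Ltac def_fun_extra ::=
  first [ apply deffun_pairset | apply deffun_sing | apply deffun_op | apply deffun_bigunion
        | apply deffun_bunion | apply deffun_suc ]; [eassumption|..].
Ltac def_rel_extra ::= first [ apply def_inductive_set ]; [eassumption|..].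

(** * Sets over urelements *)

Section Urelements.
Local Open Scope zf_scope.
Context {V : structure Empty_set} (HV : models V ZF).
Implicit Types (x y z a b c d m n u w T : V).

Local Notation "∅" := empty.

(* A nonempty set stands for an urelement if ∅ is not one of its members, and
   otherwise for the set of its members other than ∅. *)
Definition win x y : Prop := x <> ∅ /\ x ∊ y /\ ∅ ∊ y.

Definition wtrans T : Prop := forall a, a ∊ T -> forall b, win b a -> b ∊ T.

(** The descendants of [x] along [win] fit into a set. Foundation, which speaks of sets only, then
    yields induction along [win] without a prior construction of transitive closures. *)
Definition hereditary x : Prop := exists T, wtrans T /\ x ∊ T.

Lemma def_win f g : DefFun f -> DefFun g -> Def (fun e => win (f e) (g e)).
Proof. apply def_rel2; unfold win; def. Qed.

Lemma def_wtrans f : DefFun f -> Def (fun e => wtrans (f e)).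
Proof. apply def_rel1; unfold wtrans; def; apply def_win; def. Qed.

Lemma def_hereditary f : DefFun f -> Def (fun e => hereditary (f e)).
Proof. apply def_rel1; unfold hereditary; def; apply def_wtrans; def. Qed.

Lemma hereditary_win x a : hereditary x -> win a x -> hereditary a.
Proof. intros (T & HT & Hx) Ha; exists T; split; [exact HT|]; now apply (HT x). Qed.

Lemma hereditary_ind (P : V -> Prop) : Def (fun e => P (e 0)) ->
  (forall x, hereditary x -> (forall a, win a x -> P a) -> P x) ->
  forall x, hereditary x -> P x.
Proof.
  intros D Hstep x (T & HT & Hx); apply NNPP; intros HP.
  destruct (@foundation_def V HV (fun x => ~ P x) T) as (y & Hy & HPy & Hmin); [def|eauto|].
  apply HPy, Hstep; [now exists T|].
  intros a Ha; apply NNPP; intros HPa; apply (Hmin a); [apply Ha|now apply (HT y)|exact HPa].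
Qed.

(** ** The action on sets of a family of maps of urelements *)

Context (act : V -> V -> V) (act_def : Def (fun e => e 0 = act (e 1) (e 2)))
  (act_urelement : forall c u, ~ ∅ ∊ u -> ~ ∅ ∊ act c u)
  (act_nonempty : forall c u, ~ ∅ ∊ u -> u <> ∅ -> act c u <> ∅)
  (act_invol : forall c u, ~ ∅ ∊ u -> act c (act c u) = u).

Lemma deffun_act f g : DefFun f -> DefFun g -> DefFun (fun e => act (f e) (g e)).
Proof. now apply deffun2. Qed.

(** A set-sized piece of the recursion that extends [act c] from urelements to sets. The middle
    clause closes the domain under [win]; [z = ∅] in the last one keeps the marker that makes the
    value a set. *)
Definition approx c f : Prop := forall a b, op a b ∊ f ->
  (~ ∅ ∊ a /\ b = act c a) \/
  (∅ ∊ a /\ (forall a', win a' a -> exists b', op a' b' ∊ f) /\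
   forall z, z ∊ b <-> z = ∅ \/ exists a', win a' a /\ op a' z ∊ f).

Definition im c x y : Prop := exists f, approx c f /\ op x y ∊ f.

Lemma def_im f g h : DefFun f -> DefFun g -> DefFun h -> Def (fun e => im (f e) (g e) (h e)).
Proof.
  apply def_rel3; unfold im, approx.
  repeat first [apply def_win | apply deffun_act | apply deffun_op | def_step]; assumption.
Qed.

Lemma mem_dom a b f : op a b ∊ f -> a ∊ bigunion (bigunion f).
Proof.
  intros H; apply (mem_bigunion HV); exists (sing a); split; [|now apply mem_sing].
  apply (mem_bigunion HV); exists (op a b); split; [exact H|].
  apply mem_pairset; auto.
Qed.

(** At a minimal point of disagreement the members have the same images under both approximations,
    hence so has the set. Foundation is applied inside the double union of [f], because [a] lies two
    membership steps below [op a b]. *)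
Lemma im_fun c x y y' : im c x y -> im c x y' -> y = y'.
Proof.
  intros (f & Hf & Hx) (f' & Hf' & Hx'); apply NNPP; intros Hne.
  destruct (@foundation_def V HV
    (fun x => ~ forall y y', op x y ∊ f -> op x y' ∊ f' -> y = y') (bigunion (bigunion f)))
    as (a & Ha & HP & Hmin).
  { repeat first [apply deffun_op | def_step]; assumption. }
  { exists x; split; [now apply mem_dom with y|auto]. }
  apply HP; clear HP; intros b b' Hb Hb'.
  destruct (Hf a b Hb) as [[Hu ->]|(Hs & Hd & Hv)], (Hf' a b' Hb') as [[Hu' ->]|(Hs' & Hd' & Hv')];
    try tauto.
  assert (E : forall a' z, win a' a -> op a' z ∊ f <-> op a' z ∊ f').
  { intros a' z Ha'.
    destruct (Hd a' Ha') as [z1 H1], (Hd' a' Ha') as [z2 H2].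
    assert (EQ : forall y y', op a' y ∊ f -> op a' y' ∊ f' -> y = y').
    { apply NNPP; apply Hmin; [apply Ha'|now apply mem_dom with z1]. }
    split; intros Hz.
    - rewrite (EQ z z2); auto.
    - rewrite <- (EQ z1 z); auto. }
  apply (set_ext HV); intro z; rewrite Hv, Hv'.
  split; (intros [->|(a' & Ha' & Hz)]; [now left|right]);
    exists a'; (split; [exact Ha'|now apply (E a' z)]).
Qed.

(** At a minimal point [a] without a value, replacement collects the graph [F] of [im c] on the rest
    of [T] and also the value [b] that [a] should have; [F] with the pair of [a] and [b] is then an
    approximation at [a]. *)
Lemma im_total c x : hereditary x -> exists y, im c x y.
Proof.
  intros (T & HT & Hx); apply NNPP; intros Hno.
  destruct (@foundation_def V HV (fun x => ~ exists y, im c x y) T) as (a & Ha & HP & Hmin).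
  { def; apply def_im; def. }
  { eauto. }
  assert (Hel : forall a', win a' a -> exists y, im c a' y).
  { intros a' Ha'; apply NNPP; apply Hmin; [apply Ha'|now apply (HT a)]. }
  clear Hmin; destruct (classic (∅ ∊ a)) as [Hs|Hu].
  2:{ apply HP; exists (act c a), (sing (op a (act c a))); split; [|now apply mem_sing].
      intros p q Hpq; apply (mem_sing HV), (op_inj HV) in Hpq; destruct Hpq as [-> ->]; auto. }
  destruct (@separation_def V HV (fun x => exists y, im c x y) T) as [D HD].
  { def; apply def_im; def. }
  destruct (@replacement_def V HV (fun z p => exists y, im c z y /\ p = op z y) D) as [F HF].
  { repeat first [apply def_im | apply deffun_op | def_step]; assumption. }
  { intros z Hz; apply HD in Hz; destruct Hz as [_ [y Hy]]; exists (op z y).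
    intros p; split; [|intros ->; eauto].
    intros (y' & Hy' & ->); now rewrite (im_fun Hy Hy'). }
  assert (HF' : forall p q, op p q ∊ F <-> p ∊ T /\ im c p q).
  { intros p q; rewrite HF; split.
    - intros (z & Hz & y & Hy & E); apply (op_inj HV) in E; destruct E as [-> ->].
      apply HD in Hz; tauto.
    - intros [H1 H2]; exists p; split; [apply HD; eauto|eauto]. }
  destruct (@replacement_def V HV (fun z y => im c z y) D) as [R HR].
  { apply def_im; def. }
  { intros z Hz; apply HD in Hz; destruct Hz as [_ [y Hy]]; exists y.
    intros p; split; [intros H; now rewrite (im_fun Hy H)|now intros ->]. }
  destruct (@separation_def V HV (fun y => y = ∅ \/ exists a', win a' a /\ im c a' y)
              (bunion (sing ∅) R)) as [b Hb].
  { repeat first [apply def_im | apply def_win | def_step]; assumption. }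
  assert (Hb' : forall z, z ∊ b <-> z = ∅ \/ exists a', win a' a /\ im c a' z).
  { intros z; rewrite Hb, (mem_bunion HV), (mem_sing HV); split; [tauto|].
    intros H; split; [|exact H]; destruct H as [|(a' & H1 & H2)]; [now left|right].
    apply HR; exists a'; split; [apply HD; split; [now apply (HT a)|eauto]|exact H2]. }
  apply HP; exists b, (bunion F (sing (op a b))).
  assert (HFb : forall p q, op p q ∊ bunion F (sing (op a b)) <->
             (p ∊ T /\ im c p q) \/ (p = a /\ q = b)).
  { intros; rewrite (mem_bunion HV), (mem_sing HV), HF'; split; intros [H|H]; auto; right.
    - now apply op_inj.
    - destruct H as [-> ->]; reflexivity. }
  split; [|apply HFb; auto].
  (* No approximation has a value at [a], so the new pair cannot interfere with the values taken
     over from older ones. *)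
  assert (Hga : forall z, ~ im c a z) by (intros z Hz; apply HP; eauto).
  intros p q Hpq; apply HFb in Hpq; destruct Hpq as [[HpT (f & Hf & Hpq)]|[-> ->]].
  - destruct (Hf p q Hpq) as [H|(H1 & H2 & H3)]; [now left|right].
    assert (Hin : forall a', win a' p -> forall z, op a' z ∊ f -> im c a' z)
      by (intros; exists f; auto).
    split; [exact H1|split].
    + intros a' Ha'; destruct (H2 a' Ha') as [b' Hb'']; exists b'; apply HFb; left.
      split; [now apply (HT p)|exists f; auto].
    + intros z; rewrite H3; split; (intros [->|(a' & Ha' & Hz)]; [now left|right]);
        exists a'; (split; [exact Ha'|]).
      * apply HFb; left; split; [now apply (HT p)|now exists f].
      * apply HFb in Hz; destruct Hz as [[_ Hz]|[-> _]].
        -- destruct (H2 a' Ha') as [z' Hz'].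
           rewrite (im_fun Hz (Hin a' Ha' z' Hz')); exact Hz'.
        -- destruct (H2 a Ha') as [z' Hz']; destruct (Hga z'); eauto.
  - right; split; [exact Hs|split].
    + intros a' Ha'; destruct (Hel a' Ha') as [y Hy]; exists y; apply HFb; left.
      split; [now apply (HT a)|exact Hy].
    + intros z; rewrite Hb'; split; (intros [->|(a' & Ha' & Hz)]; [now left|right]);
        exists a'; (split; [exact Ha'|]).
      * apply HFb; left; split; [now apply (HT a)|exact Hz].
      * apply HFb in Hz; destruct Hz as [[_ Hz]|[-> _]]; [exact Hz|].
        destruct Ha' as (_ & Ha' & _); now apply (no_loop HV) in Ha'.
Qed.

(* Taking the union over all (that is, at most one) values of [im] makes this
   function total and definable everywhere. *)
Definition img c x : V := setof (fun z => exists y, im c x y /\ z ∊ y).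

Lemma small_img c x : small (fun z => exists y, im c x y /\ z ∊ y).
Proof.
  destruct (classic (exists y, im c x y)) as [[y Hy]|H].
  - exists y; intro z; split; [eauto|].
    intros (y' & Hy' & Hz); now rewrite (im_fun Hy Hy').
  - exists ∅; intro z; split; [now intros ?%mem_empty|intros (y & Hy & _); destruct H; eauto].
Qed.

Lemma deffun_img f g : DefFun f -> DefFun g -> DefFun (fun e => img (f e) (g e)).
Proof.
  apply deffun2; apply (@deffun_setof V HV (fun e z => exists y, im (e 0) (e 1) y /\ z ∊ y)).
  - intro; apply small_img.
  - repeat first [apply def_im | def_step].
Qed.

Lemma im_img c x y : im c x y -> img c x = y.
Proof.
  intros H; apply (set_ext HV); intro z; unfold img; rewrite mem_setof by apply small_img.
  split; [|eauto]; intros (y' & Hy' & Hz); now rewrite (im_fun H Hy').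
Qed.

Lemma img_im c x : hereditary x -> im c x (img c x).
Proof.
  intros H; destruct (im_total c H) as [y Hy]; now rewrite (im_img Hy).
Qed.

Lemma img_urelement c x : ~ ∅ ∊ x -> img c x = act c x.
Proof.
  intros Hx; apply im_img; exists (sing (op x (act c x))); split; [|now apply mem_sing].
  intros p q Hpq; apply (mem_sing HV), (op_inj HV) in Hpq; destruct Hpq as [-> ->]; auto.
Qed.

Lemma mem_img c x z : hereditary x -> ∅ ∊ x ->
  z ∊ img c x <-> z = ∅ \/ exists a, win a x /\ z = img c a.
Proof.
  intros H Hs; destruct (img_im c H) as (f & Hf & Hx).
  destruct (Hf _ _ Hx) as [[Hu _]|(_ & H2 & H3)]; [tauto|].
  rewrite H3; split; (intros [->|(a & Ha & Hz)]; [now left|right]); exists a; (split; [exact Ha|]).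
  - symmetry; apply im_img; exists f; auto.
  - destruct (H2 a Ha) as [b Hb]; subst z; rewrite (@im_img c a b); [exact Hb|exists f; auto].
Qed.

Lemma img_set c x : hereditary x -> (∅ ∊ img c x <-> ∅ ∊ x).
Proof.
  intros H; destruct (classic (∅ ∊ x)) as [Hx|Hx].
  - rewrite (mem_img _ _ H Hx); tauto.
  - rewrite (img_urelement _ _ Hx); specialize (act_urelement c _ Hx); tauto.
Qed.

Lemma img_nonempty c x : hereditary x -> x <> ∅ -> img c x <> ∅.
Proof.
  intros H Hx; destruct (classic (∅ ∊ x)) as [Hs|Hs].
  - apply (img_set c H) in Hs; intros E; rewrite E in Hs; now apply mem_empty in Hs.
  - rewrite img_urelement; auto.
Qed.

Lemma win_img c x a : hereditary x -> (win a (img c x) <-> exists b, win b x /\ a = img c b).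
Proof.
  intros H; split.
  - intros (H1 & H2 & H3); rewrite (img_set c H) in H3.
    apply (mem_img _ _ H H3) in H2; tauto.
  - intros (b & Hb & ->); split; [apply img_nonempty; [now apply hereditary_win with x|apply Hb]|].
    split; [apply (mem_img _ _ H)|apply (img_set _ H)]; try apply Hb; eauto.
Qed.

Lemma hereditary_img c x : hereditary x -> hereditary (img c x).
Proof.
  intros (T & HT & Hx).
  assert (D : Def (fun e : nat -> V => e 0 = img c (e 1)))
    by (apply (@deffun_img (fun _ => c) (fun e => e 0)); def).
  exists (image (img c) T); split; [|apply (mem_image HV); eauto].
  intros a Ha b Hb; apply (mem_image HV) in Ha; [|exact D]; destruct Ha as (a0 & Ha & ->).
  apply win_img in Hb; [|now exists T]; destruct Hb as (b0 & Hb & ->).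
  apply (mem_image HV); [exact D|]; exists b0; split; [now apply (HT a0)|reflexivity].
Qed.

Lemma img_invol c x : hereditary x -> img c (img c x) = x.
Proof.
  revert x; apply (hereditary_ind (fun x => img c (img c x) = x)).
  { def; repeat apply deffun_img; def. }
  intros x H IH; destruct (classic (∅ ∊ x)) as [Hs|Hu].
  - apply (set_ext HV); intro z; rewrite mem_img; [|now apply hereditary_img|now apply img_set].
    setoid_rewrite (win_img c _ H); split.
    + intros [->|(a & (b & Hb & ->) & ->)]; [exact Hs|]; rewrite IH; apply Hb.
    + intros Hz; destruct (classic (z = ∅)) as [|Hz0]; [now left|right].
      assert (Hw : win z x) by (split; auto).
      exists (img c z); split; [eauto|now rewrite IH].
  - rewrite (img_urelement _ _ Hu), img_urelement; auto.
Qed.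

Lemma img_win c x y : hereditary x -> hereditary y -> (win (img c x) (img c y) <-> win x y).
Proof.
  intros Hx Hy; rewrite (win_img c _ Hy); split; [|eauto].
  intros (b & Hb & E).
  rewrite <- (img_invol c Hx), E, img_invol; [exact Hb|now apply hereditary_win with y].
Qed.

Lemma img_commute c d x : (forall u, ~ ∅ ∊ u -> act c (act d u) = act d (act c u)) ->
  hereditary x -> img c (img d x) = img d (img c x).
Proof.
  intros Hcd; revert x; apply (hereditary_ind (fun x => img c (img d x) = img d (img c x))).
  { def; repeat apply deffun_img; def. }
  intros x H IH; destruct (classic (∅ ∊ x)) as [Hs|Hu].
  - apply (set_ext HV); intro z.
    rewrite !mem_img; try apply hereditary_img; try apply img_set; auto.
    setoid_rewrite (win_img c _ H); setoid_rewrite (win_img d _ H).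
    split; (intros [->|(a & (b & Hb & ->) & ->)]; [now left|right]).
    + exists (img c b); rewrite IH; eauto.
    + exists (img d b); rewrite IH; eauto.
  - rewrite !(img_urelement _ _ Hu), !img_urelement; auto.
Qed.

(** Invariance is asked in one direction only: [img c] is an involution, so it maps the members of
    [x] onto themselves as soon as it maps them into [x]. *)
Lemma img_fixed c x : hereditary x -> ∅ ∊ x -> (forall a, win a x -> win (img c a) x) -> img c x = x.
Proof.
  intros H Hs Hc; apply (set_ext HV); intro z; rewrite (mem_img _ _ H Hs); split.
  - intros [->|(a & Ha & ->)]; [exact Hs|]; now apply Hc.
  - intros Hz; destruct (classic (z = ∅)) as [|Hz0]; [now left|right].
    assert (Hw : win z x) by (split; auto).
    exists (img c z); split; [auto|]; symmetry; apply img_invol; now apply hereditary_win with x.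
Qed.

(** Below the members of [T] there are no urelements to move; a minimal moved member would have all
    its members fixed. *)
Lemma img_pure c T : wtrans T -> (forall z, z ∊ T -> ∅ ∊ z) -> forall z, z ∊ T -> img c z = z.
Proof.
  intros HT Hp z Hz; apply NNPP; intros Hne.
  destruct (@foundation_def V HV (fun z => img c z <> z) T) as (a & Ha & HP & Hmin).
  { def; apply deffun_img; def. }
  { eauto. }
  apply HP, img_fixed; [now exists T|auto|].
  intros b Hb; replace (img c b) with b; [exact Hb|].
  symmetry; apply NNPP; apply Hmin; [apply Hb|now apply (HT a)].
Qed.

(** ** Hereditarily symmetric sets *)

(* [G m] generates the m-th group of a descending sequence of groups, and these
   generate the filter of stabilizers. *)
Context (G : V -> V -> Prop) (G_def : Def (fun e => G (e 0) (e 1)))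
  (G_mono : forall m n c, (forall k, k ∊ m -> k ∊ n) -> G n c -> G m c)
  (G_commute : forall c, exists m, m ∊ ω /\ forall d, G m d -> forall u, ~ ∅ ∊ u ->
     act c (act d u) = act d (act c u)).

(** A set fixed by generators is fixed by the group they generate, so the groups themselves never
    have to be formed. *)
Definition supports m x : Prop := forall c, G m c -> img c x = x.

Definition symmetric x : Prop := exists m, m ∊ ω /\ supports m x.

(** [∅] is left out because it serves as the marker of sets. One closed set [T] bears witness for
    all descendants of [x], so the notion is first-order without a recursion. *)
Definition HS x : Prop := x <> ∅ /\
  exists T, wtrans T /\ x ∊ T /\ forall z, z ∊ T -> z <> ∅ /\ symmetric z.

Lemma def_HS f : DefFun f -> Def (fun e => HS (f e)).
Proof.
  apply def_rel1; unfold HS, symmetric, supports.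
  repeat first [apply deffun_img | apply def_wtrans | apply (def_rel2 _ G_def) | def_step]; assumption.
Qed.

Lemma supports_mono m n x : (forall k, k ∊ m -> k ∊ n) -> supports m x -> supports n x.
Proof. intros H S c Hc; apply S; now apply G_mono with n. Qed.

Lemma HS_nonempty x : HS x -> x <> ∅.
Proof. now intros []. Qed.

Lemma HS_hereditary x : HS x -> hereditary x.
Proof. intros (_ & T & H1 & H2 & _); now exists T. Qed.

Lemma HS_symmetric x : HS x -> symmetric x.
Proof. intros (_ & T & H1 & H2 & H3); now apply H3. Qed.

Lemma HS_win x a : HS x -> win a x -> HS a.
Proof.
  intros (_ & T & H1 & H2 & H3) Ha; split; [apply Ha|].
  exists T; split; [exact H1|split; [now apply (H1 x)|exact H3]].
Qed.

(** Takes the place of closure of the filter under conjugation: a map that fixes [x] and commutes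
    with [img c] fixes [img c x] as well. *)
Lemma symmetric_img c x : hereditary x -> symmetric x -> symmetric (img c x).
Proof.
  intros H (m & Hm & S); destruct (G_commute c) as (n & Hn & HC).
  destruct (ω_directed HV m n Hm Hn) as (k & Hk & K1 & K2).
  exists k; split; [exact Hk|]; intros d Hd.
  rewrite <- (S d) at 2 by (now apply G_mono with k).
  symmetry; apply img_commute; [|exact H]; apply HC; now apply G_mono with k.
Qed.

Lemma HS_img c x : HS x -> HS (img c x).
Proof.
  intros HX; pose proof (HS_hereditary HX) as Hh; destruct HX as (H0 & T & H1 & H2 & H3).
  split; [now apply img_nonempty|].
  assert (D : Def (fun e : nat -> V => e 0 = img c (e 1)))
    by (apply (@deffun_img (fun _ => c) (fun e => e 0)); def).
  exists (image (img c) T); split; [|split; [apply (mem_image HV); eauto|]].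
  - intros a Ha b Hb; apply (mem_image HV) in Ha; [|exact D]; destruct Ha as (a0 & Ha & ->).
    apply win_img in Hb; [|now exists T]; destruct Hb as (b0 & Hb & ->).
    apply (mem_image HV); [exact D|]; exists b0; split; [now apply (H1 a0)|reflexivity].
  - intros z Hz; apply (mem_image HV) in Hz; [|exact D]; destruct Hz as (z0 & Hz & ->).
    destruct (H3 z0 Hz); split; [apply img_nonempty|apply symmetric_img]; auto; now exists T.
Qed.

(** The least closed set around [a]. The conjunct [hereditary a] prevents an intersection over no
    sets at all, so the function is total and definable. *)
Definition wclosure a : V :=
  setof (fun z => hereditary a /\ forall T, wtrans T -> a ∊ T -> z ∊ T).

Lemma small_wclosure a : small (fun z => hereditary a /\ forall T, wtrans T -> a ∊ T -> z ∊ T).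
Proof.
  destruct (classic (hereditary a)) as [(T & HT & Ha)|H].
  - apply (@small_sub V HV) with T; [|intros z [_ Hz]; auto].
    repeat first [apply def_hereditary | apply def_wtrans | def_step].
  - exists ∅; intro z; split; [now intros ?%mem_empty|tauto].
Qed.

Lemma mem_wclosure a z : z ∊ wclosure a <-> hereditary a /\ forall T, wtrans T -> a ∊ T -> z ∊ T.
Proof. unfold wclosure; rewrite mem_setof; [reflexivity|apply small_wclosure]. Qed.

Lemma deffun_wclosure f : DefFun f -> DefFun (fun e => wclosure (f e)).
Proof.
  apply deffun1; apply (@deffun_setof V HV
    (fun e z => hereditary (e 0) /\ forall T, wtrans T -> e 0 ∊ T -> z ∊ T)).
  - intro; apply small_wclosure.
  - repeat first [apply def_hereditary | apply def_wtrans | def_step].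
Qed.

Lemma set_closure x : (forall a, win a x -> hereditary a) -> exists T, wtrans T /\
  forall z, z ∊ T <-> z = x \/ exists a, win a x /\ z ∊ wclosure a.
Proof.
  intros H.
  assert (D : Def (fun e : nat -> V => e 0 = wclosure (e 1)))
    by (apply (@deffun_wclosure (fun e => e 0)); def).
  destruct (@small_sub V HV (fun z => z = x \/ exists a, win a x /\ z ∊ wclosure a)
              (bunion (sing x) (bigunion (image wclosure x)))) as [T HT].
  - repeat first [apply def_win | apply deffun_wclosure | def_step].
  - intros z Hz; rewrite (mem_bunion HV), (mem_sing HV), (mem_bigunion HV).
    destruct Hz as [|(a & Ha & Hz)]; [now left|right].
    exists (wclosure a); split; [|exact Hz]; apply (mem_image HV); [exact D|].
    exists a; split; [apply Ha|reflexivity].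
  - exists T; split; [|exact HT]; intros a Ha b Hb; apply HT in Ha; apply HT; right.
    destruct Ha as [->|(a' & Ha' & Ha)].
    + exists b; split; [exact Hb|]; apply mem_wclosure; auto.
    + exists a'; split; [exact Ha'|]; apply mem_wclosure in Ha; apply mem_wclosure.
      split; [apply Ha|]; intros T' HT' HT''; apply (HT' a); [now apply Ha|exact Hb].
Qed.

Lemma hereditary_intro x : (forall a, win a x -> hereditary a) -> hereditary x.
Proof.
  intros H; destruct (set_closure H) as (T & HT & HT'); exists T; split; [exact HT|].
  apply HT'; auto.
Qed.

Lemma HS_intro x : x <> ∅ -> (forall a, win a x -> HS a) -> symmetric x -> HS x.
Proof.
  intros Hx Ha S; split; [exact Hx|].
  destruct (@set_closure x) as (T & HT & HT'); [intros a Hw; now apply HS_hereditary, Ha|].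
  exists T; split; [exact HT|split; [apply HT'; auto|]].
  intros z Hz; apply HT' in Hz; destruct Hz as [->|(a & Hw & Hz)]; [auto|].
  apply mem_wclosure in Hz; destruct (Ha a Hw) as (_ & T' & H1 & H2 & H3).
  now apply H3, Hz.
Qed.

Lemma HS_urelement u : ~ ∅ ∊ u -> u <> ∅ -> symmetric u -> HS u.
Proof. intros H1 H2 H3; apply HS_intro; auto; intros a (_ & _ & H); tauto. Qed.

(** Source of almost all sets of the model: by [img_fixed], invariance of the family under [G m]
    becomes support [m] of the set, to which [∅] is added as marker. *)
Lemma HS_comprehension (P : V -> Prop) w m : Def (fun e => P (e 0)) ->
  (forall z, P z -> HS z) -> (forall z, P z -> z ∊ w) ->
  m ∊ ω -> (forall c z, G m c -> P z -> P (img c z)) ->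
  exists s, HS s /\ ∅ ∊ s /\ supports m s /\ forall z, win z s <-> P z.
Proof.
  intros D HP Hw Hm HG.
  destruct (@small_sub V HV (fun z => z = ∅ \/ P z) (bunion (sing ∅) w)) as [s Hs]; [def|..].
  { intros z Hz; rewrite (mem_bunion HV), (mem_sing HV); destruct Hz; auto. }
  assert (Hs0 : ∅ ∊ s) by (apply Hs; auto).
  assert (Hsw : forall z, win z s <-> P z).
  { intros z; unfold win; rewrite Hs; split; [tauto|].
    intros Hz; split; [now apply HS_nonempty, HP|tauto]. }
  assert (Hh : hereditary s).
  { apply hereditary_intro; intros a Ha; now apply HS_hereditary, HP, Hsw. }
  assert (HSup : supports m s).
  { intros c Hc; apply img_fixed; auto; intros a Ha; apply Hsw, HG, Hsw; auto. }
  exists s; split; [|auto]; apply HS_intro.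
  - intros E; rewrite E in Hs0; now apply mem_empty in Hs0.
  - intros a Ha; now apply HP, Hsw.
  - now exists m.
Qed.

Lemma HS_pure T : wtrans T -> (forall z, z ∊ T -> ∅ ∊ z) -> forall z, z ∊ T -> HS z.
Proof.
  intros HT Hp z Hz.
  assert (Hne : forall z, z ∊ T -> z <> ∅).
  { intros y Hy E; apply Hp in Hy; rewrite E in Hy; now apply mem_empty in Hy. }
  split; [auto|]; exists T; split; [exact HT|split; [exact Hz|]].
  intros y Hy; split; [auto|]; exists ∅; split; [apply (empty_ω HV)|].
  intros c _; now apply img_pure with T.
Qed.

(** ** The symmetric submodel *)

Lemma HS_exists : exists x, HS x.
Proof.
  destruct (@HS_comprehension (fun _ => False) ∅ ∅) as (s & Hs & _);
    [def|tauto|tauto|apply (empty_ω HV)|tauto|now exists s].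
Qed.

Definition symmetric_model : structure lang := {|
  dom := {x : V | HS x};
  dom_inhabited :=
    let (x, Hx) := HS_exists in inhabits (exist HS x Hx);
  pred _ p := ~ ∅ ∊ proj1_sig p;
  mem p q := win (proj1_sig p) (proj1_sig q)
|}.

Local Notation M := symmetric_model.

Definition val (x : M) : V := proj1_sig x.

Definition elt x (Hx : HS x) : M := exist HS x Hx.

Lemma val_HS (x : M) : HS (val x).
Proof. exact (proj2_sig x). Qed.

Lemma val_inj (x y : M) : val x = val y -> x = y.
Proof.
  destruct x as [x Hx], y as [y Hy]; simpl; intros E; now apply subset_eq_compat.
Qed.

(** Relativization to [HS]. Its environments live in [V], so that satisfaction in the submodel can
    be shown definable in [V]. *)
Fixpoint rsat (e : nat -> V) (φ : form lang) : Prop :=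
  match φ with
  | Pred _ x => ~ ∅ ∊ e x
  | Mem x y => win (e x) (e y)
  | Eq x y => e x = e y
  | Bot => False
  | Imp φ ψ => rsat e φ -> rsat e ψ
  | And φ ψ => rsat e φ /\ rsat e ψ
  | Or φ ψ => rsat e φ \/ rsat e ψ
  | All φ => forall a, HS a -> rsat (scons a e) φ
  | Ex φ => exists a, HS a /\ rsat (scons a e) φ
  end.

Lemma scons_map (g : M -> V) (a : M) (e : nat -> M) :
  scons (g a) (fun k => g (e k)) = fun k => g (scons a e k).
Proof. apply functional_extensionality; now intros [|k]. Qed.

Lemma sat_rsat φ : forall e : nat -> M, sat M e φ <-> rsat (fun k => val (e k)) φ.
Proof.
  induction φ; simpl; intros e; try reflexivity.
  - split; [now intros ->|apply val_inj].
  - now rewrite IHφ1, IHφ2.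
  - now rewrite IHφ1, IHφ2.
  - now rewrite IHφ1, IHφ2.
  - split; intros H a.
    + intros Ha; change a with (val (elt Ha)); rewrite scons_map, <- IHφ; apply H.
    + rewrite IHφ, <- scons_map; apply H, val_HS.
  - split; intros [a H].
    + exists (val a); split; [apply val_HS|]; now rewrite scons_map, <- IHφ.
    + destruct H as [Ha H]; exists (elt Ha); rewrite IHφ, <- scons_map; exact H.
Qed.

Lemma def_rsat φ : Def (fun e => rsat e φ).
Proof.
  assert (Hs : forall e : nat -> V, scons (e 0) (fun k => e (S k)) = e)
    by (intro; apply functional_extensionality; now intros [|k]).
  induction φ; simpl; repeat first [apply def_win | def_step].
  - apply def_HS; def.
  - revert IHφ; apply def_iff_mono; intro e; now rewrite Hs.
  - apply def_HS; def.
  - revert IHφ; apply def_iff_mono; intro e; now rewrite Hs.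
Qed.

Lemma def_rsat1 φ (p : nat -> V) : Def (fun e => rsat (scons (e 0) p) φ).
Proof.
  pose proof (def_comp (fun k => match k with 0 => inl 0 | S k => inr (p k) end) (def_rsat φ)) as D.
  revert D; apply def_iff_mono; intro e.
  replace (scons (e 0) p) with
    (fun k => look e match k with 0 => inl 0 | S k => inr (p k) end); [reflexivity|].
  apply functional_extensionality; now intros [|k].
Qed.

Lemma def_rsat2 φ (p : nat -> V) : Def (fun e => rsat (scons (e 0) (scons (e 1) p)) φ).
Proof.
  pose proof (def_comp (fun k =>
    match k with 0 => inl 0 | 1 => inl 1 | S (S k) => inr (p k) end) (def_rsat φ)) as D.
  revert D; apply def_iff_mono; intro e.
  replace (scons (e 0) (scons (e 1) p)) with
    (fun k => look e match k with 0 => inl 0 | 1 => inl 1 | S (S k) => inr (p k) end); [reflexivity|].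
  apply functional_extensionality; now intros [|[|k]].
Qed.

Definition move c (x : M) : M := elt (HS_img c (val_HS x)).

Lemma sat_move c φ (e : nat -> M) : sat M (fun k => move c (e k)) φ <-> sat M e φ.
Proof.
  assert (Hinv : forall x : M, move c (move c x) = x)
    by (intros x; apply val_inj, (img_invol c (HS_hereditary (val_HS x)))).
  apply sat_automorphism.
  - intros y; exists (move c y); auto.
  - intros x y E; rewrite <- (Hinv x), E; auto.
  - intros [] x; simpl; now rewrite (img_set c (HS_hereditary (val_HS x))).
  - intros x y; apply img_win; apply HS_hereditary, val_HS.
Qed.

(** Infinitely many values need not have a common support, hence the bound [j]; a formula depends on
    finitely many of them only. *)
Lemma common_support (e : nat -> M) (j : nat) :
  exists m, m ∊ ω /\ forall k : nat, k < j -> supports m (val (e k)).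
Proof.
  induction j as [|j (m & Hm & IH)].
  - exists ∅; split; [apply (empty_ω HV)|intros; lia].
  - destruct (HS_symmetric (val_HS (e j))) as (m' & Hm' & S).
    destruct (ω_directed HV m m' Hm Hm') as (l & Hl & L1 & L2).
    exists l; split; [exact Hl|]; intros k Hk; destruct (Nat.eq_dec k j) as [->|].
    + now apply supports_mono with m'.
    + apply supports_mono with m; [exact L1|]; apply IH; lia.
Qed.

Lemma model_comprehension φ (e : nat -> M) w :
  (forall z : M, sat M (scons z e) φ -> val z ∊ w) ->
  exists s : M, ~ pred M tt s /\ forall z : M, mem M z s <-> sat M (scons z e) φ.
Proof.
  intros Hw; destruct (common_support e (bound φ)) as (m & Hm & Hsup).
  set (P v := HS v /\ rsat (scons v (fun k => val (e k))) φ).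
  assert (HP : forall z : M, P (val z) <-> sat M (scons z e) φ).
  { intros z; unfold P; rewrite sat_rsat, <- scons_map.
    split; [tauto|]; split; [apply val_HS|assumption]. }
  destruct (@HS_comprehension P w m) as (s & Hs & Hs0 & _ & Hsz).
  - apply def_and; [apply def_HS; def|apply def_rsat1].
  - now intros z [].
  - intros z [Hz H]; apply (Hw (elt Hz)), HP; now split.
  - exact Hm.
  - intros c z Hc [Hz H].
    (* [move c] is an automorphism that fixes every parameter occurring free in [φ], so satisfaction
       at [z] passes to the image of [z]. *)
    apply (HP (move c (elt Hz))).
    rewrite (@sat_bounded _ M φ _ (fun k => move c (scons (elt Hz) e k))).
    + apply sat_move, HP; now split.
    + intros [|k] Hk; [reflexivity|]; simpl; apply val_inj; symmetry; apply Hsup; [lia|exact Hc].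
  - exists (elt Hs); split; [simpl; tauto|]; intros z; rewrite <- HP; apply Hsz.
Qed.

(** A nonzero number has [∅] as a member, so it stands for the set of its nonzero members. Thus
    [sing ∅] is the empty set of the model, [suc n] stands for the von Neumann number n, and [ω] for
    the set of all of these. *)
Lemma HS_ω n : n ∊ suc ω -> n <> ∅ -> HS n.
Proof.
  destruct (@separation_def V HV (fun x => x <> ∅) (suc ω)) as [T HT]; [def|].
  assert (Hsub : forall x, x ∊ suc ω -> forall y, y ∊ x -> y ∊ suc ω).
  { intros x Hx y Hy; apply (mem_suc HV) in Hx; apply (mem_suc HV); left.
    destruct Hx as [Hx| ->]; [|exact Hy]; now apply (ω_sub HV) with x. }
  intros Hn Hn0; apply HS_pure with T; [..|now apply HT].
  - intros a Ha b (Hb0 & Hb & _); apply HT in Ha; apply HT; split; [|exact Hb0].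
    now apply (Hsub a).
  - intros z Hz; apply HT in Hz; destruct Hz as [Hz Hz0]; apply (mem_suc HV) in Hz.
    destruct Hz as [Hz| ->]; [|apply (empty_ω HV)].
    destruct (ω_zero HV z Hz); tauto.
Qed.

Lemma model_ZFU_R : models M ZFU_R.
Proof.
  intros φ Hφ e; destruct Hφ as [|φ Hφ]; [|destruct Hφ].
  - intros x Hx [y Hy]; simpl in *; now apply Hx, Hy.
  - intros x y (Hx & Hy & H); simpl in *; apply NNPP in Hx, Hy.
    apply val_inj, (set_ext HV); intro z; destruct (classic (z = ∅)) as [->|Hz]; [tauto|].
    split; intros Hzx.
    + assert (Hw : win z (val y)) by (split; auto).
      now apply (H (elt (HS_win (val_HS y) Hw))).
    + assert (Hw : win z (val x)) by (split; auto).
      now apply (H (elt (HS_win (val_HS x) Hw))).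
  - intros a [b Hb]; simpl in *.
    destruct (@foundation_def V HV (fun z => win z (val a)) (val a)) as (z & Hz & Hza & Hmin).
    { apply def_win; def. }
    { exists (val b); split; [apply Hb|exact Hb]. }
    exists (elt (HS_win (val_HS a) Hza)); split; [exact Hza|].
    intros (c & Hc1 & Hc2); apply (Hmin (val c)); [apply Hc1|apply Hc2|exact Hc2].
  - intros a b; simpl.
    apply (@model_comprehension (Or (Eq 0 1) (Eq 0 2)) (scons b (scons a e)) (pairset (val b) (val a))).
    simpl; intros z [->| ->]; apply (mem_pairset HV); auto.
  - intros a.
    apply (@model_comprehension (Ex (And (Mem 0 2) (Mem 1 0))) (scons a e) (bigunion (val a))).
    intros z (y & Hy & Hz); apply (mem_bigunion HV); exists (val y); split; [apply Hy|apply Hz].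
  - intros a.
    (* Every subset carries the marker [∅], which [val a] lacks when [a] is an urelement; hence the
       added [sing ∅] in the bound. *)
    destruct (@model_comprehension
      (And (Imp (Pred tt 0) Bot) (All (Imp (Mem 0 1) (Mem 0 2))))
      (scons a e) (power (bunion (val a) (sing ∅)))) as [s Hs]; [|now exists s].
    simpl; intros z [Hset Hz]; apply (mem_power HV); intros y Hy.
    apply (mem_bunion HV); destruct (classic (y = ∅)) as [->|Hy0];
      [right; now apply (mem_sing HV)|left].
    assert (Hw : win y (val z)) by (split; [auto|split; [auto|now apply NNPP]]).
    apply (Hz (elt (HS_win (val_HS z) Hw)) Hw).
  - assert (Hne : forall x, suc x <> ∅).
    { intros x E; apply (@mem_empty V HV x); rewrite <- E; apply (mem_suc HV); auto. }
    assert (Hz : sing ∅ = suc ∅ :> V).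
    { apply (set_ext HV); intro z; rewrite (mem_suc HV), (mem_sing HV).
      split; [tauto|]; intros [H|H]; [now apply mem_empty in H|exact H]. }
    assert (Hω : HS (ω : V)).
    { apply HS_ω; [apply (mem_suc HV); auto|]; intros E; apply (@mem_empty V HV ∅).
      rewrite <- E at 2; apply (empty_ω HV). }
    assert (Hsuc : forall x, x ∊ ω -> HS (suc x)).
    { intros x Hx; apply HS_ω; [|apply Hne]; apply (mem_suc HV); left; now apply suc_ω. }
    exists (elt Hω); simpl; split; [intros []; apply (empty_ω HV)|split].
    + exists (elt (Hsuc ∅ (empty_ω HV))); simpl; unfold win; rewrite <- Hz, (mem_sing HV).
      split; [|split; [tauto|]].
      * rewrite Hz; split; [apply Hne|split; [apply (suc_ω HV)|]; apply (empty_ω HV)].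
      * intros [y Hy]; simpl; rewrite (mem_sing HV); tauto.
    + intros [x Hx]; simpl; intros (Hx0 & Hxω & _).
      destruct (ω_zero HV x Hxω) as [|H0]; [tauto|].
      exists (elt (Hsuc x Hxω)); simpl; split; [|split].
      * split; [apply Hne|split; [now apply (suc_ω HV)|apply (empty_ω HV)]].
      * intros []; apply (mem_suc HV); auto.
      * intros [z Hz']; simpl; unfold win; rewrite !(mem_suc HV); split.
        -- intros (H1 & [H2| ->] & _); [auto|right; now apply subset_eq_compat].
        -- intros [H|H]; [tauto|]; injection H as ->; auto.
  - revert e; change (holds M (separation isset φ)); unfold separation.
    rewrite holds_close; intros e w.
    destruct (@model_comprehension (And (Mem 0 1) (ren (args [0] 2) φ)) (scons w e) (val w))
      as (s & Hs & Hsz); [intros z [Hz _]; apply Hz|].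
    exists s; split; [exact Hs|]; intros z; specialize (Hsz z).
    cbn [sat] in *; rewrite sat_ren in *.
    rewrite (sat_ext M φ _ (fun k => scons z (scons w e) (args [0] 2 k))); [exact Hsz|].
    intros [|[|k]]; reflexivity.
  - revert e; change (holds M (replacement φ)); unfold replacement.
    rewrite holds_close; intros e w H; cbn [sat] in *.
    setoid_rewrite sat_ren in H; setoid_rewrite sat_ren.
    assert (H' : forall x : M, mem M x w -> exists y : M, forall y' : M,
              sat M (scons x (scons y' e)) φ <-> y' = y).
    { intros x Hx; destruct (H x Hx) as [y Hy]; exists y; intros y'.
      rewrite (sat_ext M φ _
        (fun k => scons y' (scons y (scons x (scons w e))) (args [2; 0] 4 k)));
        [apply (Hy y')|intros [|[|[|k]]]; reflexivity]. }
    clear H.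
    destruct (@separation_def V HV (fun x => win x (val w)) (val w)) as [w' Hw'].
    { apply def_win; def. }
    destruct (@replacement_def V HV
      (fun x y => HS y /\ rsat (scons x (scons y (fun k => val (e k)))) φ) w') as [v Hv].
    { apply def_and; [apply def_HS; def|apply def_rsat2]. }
    { intros x Hx; apply Hw' in Hx; destruct Hx as [_ Hx].
      set (x' := elt (HS_win (val_HS w) Hx)).
      destruct (H' x' Hx) as [y Hy]; exists (val y); intros y'.
      split.
      - intros [Hy' R]; specialize (Hy (elt Hy')); rewrite sat_rsat, <- !scons_map in Hy.
        apply Hy in R; now rewrite <- R.
      - intros ->; split; [apply val_HS|]; specialize (Hy y).
        rewrite sat_rsat, <- !scons_map in Hy; now apply Hy. }
    assert (HE : forall x y : M, sat M (scons x (scons y (scons w e))) (ren (args [0; 1] 3) φ)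
              <-> sat M (scons x (scons y e)) φ).
    { intros x y; rewrite sat_ren; apply sat_ext; intros [|[|[|k]]]; reflexivity. }
    (* Uniqueness is what bounds the family of all values by the set [v], and this family, being
       definable, is symmetric. Without uniqueness all values together may form a proper class,
       while a bounded selection of them need not be symmetric; so the argument does not extend to
       Collection. *)
    destruct (@model_comprehension (Ex (And (Mem 0 2) (ren (args [0; 1] 3) φ))) (scons w e) v)
      as (s & _ & Hs).
    { intros y (x & Hx & R); rewrite HE in R; apply Hv; exists (val x).
      split; [apply Hw'; split; [apply Hx|exact Hx]|split; [apply val_HS|]].
      rewrite sat_rsat, <- !scons_map in R; exact R. }
    exists s; intros x Hx; destruct (H' x Hx) as [y Hy]; exists y.
    assert (R : sat M (scons x (scons y e)) φ) by now apply Hy.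
    split; [apply Hs; exists x; split; [exact Hx|now apply HE]|].
    revert R; apply sat_ext; intros [|[|[|k]]]; reflexivity.
Qed.

(** ** Equinumerosity in the symmetric submodel *)

Lemma win_ext x y : ∅ ∊ x -> ∅ ∊ y -> (forall z, win z x <-> win z y) -> x = y.
Proof.
  intros Hx Hy H; apply (set_ext HV); intro z.
  destruct (classic (z = ∅)) as [->|Hz]; [tauto|].
  specialize (H z); unfold win in H; tauto.
Qed.

(** * Ordered pairs of the model *)

Definition wpair a b : V := bunion (sing ∅) (pairset a b).
Definition wop a b : V := wpair (wpair a a) (wpair a b).

Lemma deffun_wop f g : DefFun f -> DefFun g -> DefFun (fun e => wop (f e) (g e)).
Proof. intros; unfold wop, wpair; def. Qed.

Lemma empty_wpair a b : ∅ ∊ wpair a b.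
Proof. apply (mem_bunion HV); left; now apply (mem_sing HV). Qed.

Lemma wpair_nonempty a b : wpair a b <> ∅.
Proof. intros E; apply (@mem_empty V HV ∅); rewrite <- E at 2; apply empty_wpair. Qed.

Lemma win_wpair a b z : a <> ∅ -> b <> ∅ -> (win z (wpair a b) <-> z = a \/ z = b).
Proof.
  intros Ha Hb; unfold win, wpair at 1; rewrite (mem_bunion HV), (mem_sing HV), (mem_pairset HV).
  pose proof (empty_wpair a b); split; [tauto|].
  intros [->| ->]; tauto.
Qed.

Lemma HS_wpair a b : HS a -> HS b -> HS (wpair a b).
Proof.
  intros Ha Hb.
  destruct (common_support (scons (elt Ha) (fun _ => elt Hb)) 2) as (m & Hm & S).
  destruct (@HS_comprehension (fun z => z = a \/ z = b) (pairset a b) m) as (s & Hs & H0 & _ & Hz).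
  - def.
  - now intros z [->| ->].
  - intros z; apply (mem_pairset HV).
  - exact Hm.
  - intros c z Hc [->| ->]; [left; apply (S 0)|right; apply (S 1)]; auto.
  - replace (wpair a b) with s; [exact Hs|].
    apply win_ext; [exact H0|apply empty_wpair|]; intro z.
    rewrite Hz, win_wpair; [reflexivity|now apply HS_nonempty..].
Qed.

Lemma HS_wop a b : HS a -> HS b -> HS (wop a b).
Proof. intros; unfold wop; repeat apply HS_wpair; auto. Qed.

Lemma wpair_inj a b a' b' : a <> ∅ -> b <> ∅ -> a' <> ∅ -> b' <> ∅ ->
  wpair a b = wpair a' b' -> pairset a b = pairset a' b'.
Proof.
  intros Ha Hb Ha' Hb' E; apply (set_ext HV); intro z.
  now rewrite !(mem_pairset HV), <- !win_wpair, E.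
Qed.

(** Equality of [wpair] terms amounts to equality of the corresponding [pairset] terms, so the claim
    reduces to [op_inj] at both levels of the pair. *)
Lemma wop_inj a b a' b' : a <> ∅ -> b <> ∅ -> a' <> ∅ -> b' <> ∅ ->
  wop a b = wop a' b' -> a = a' /\ b = b'.
Proof.
  intros Ha Hb Ha' Hb' E; apply (op_inj HV); unfold op, sing.
  apply wpair_inj in E; [|apply wpair_nonempty..].
  assert (P : forall x, x ∊ pairset (wpair a a) (wpair a b) <->
                        x ∊ pairset (wpair a' a') (wpair a' b')) by (rewrite E; reflexivity).
  setoid_rewrite (mem_pairset HV) in P.
  assert (I : forall u v u' v', u <> ∅ -> v <> ∅ -> u' <> ∅ -> v' <> ∅ ->
            (wpair u v = wpair u' v' <-> pairset u v = pairset u' v')).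
  { intros; split; [now apply wpair_inj|]; unfold wpair; now intros ->. }
  apply (set_ext HV); intro z; rewrite !(mem_pairset HV); split.
  - intros [->| ->].
    + rewrite <- !I by auto; apply P; auto.
    + rewrite <- !I by auto; apply P; auto.
  - intros [->| ->].
    + rewrite <- !I by auto; apply P; auto.
    + rewrite <- !I by auto; apply P; auto.
Qed.

Lemma img_wpair c a b : HS a -> HS b -> img c (wpair a b) = wpair (img c a) (img c b).
Proof.
  intros Ha Hb.
  pose proof (HS_hereditary (HS_wpair Ha Hb)) as H.
  apply win_ext; [apply (img_set c H), empty_wpair|apply empty_wpair|]; intro z.
  rewrite (win_img c z H), win_wpair; [|now apply HS_nonempty, HS_img..].
  setoid_rewrite win_wpair; [|now apply HS_nonempty..].
  split.
  - intros (x & [->| ->] & ->); auto.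
  - intros [->| ->]; eauto.
Qed.

Lemma img_wop c a b : HS a -> HS b -> img c (wop a b) = wop (img c a) (img c b).
Proof. intros Ha Hb; unfold wop; rewrite !img_wpair; auto using HS_wpair. Qed.

Lemma sat_upair (e : nat -> M) p i j :
  sat M e (upair p i j) <-> val (e p) = wpair (val (e i)) (val (e j)).
Proof.
  pose proof (HS_nonempty (val_HS (e i))) as Hi; pose proof (HS_nonempty (val_HS (e j))) as Hj.
  change (sat M e (upair p i j)) with
    (forall z : M, (win (val z) (val (e p)) -> z = e i \/ z = e j) /\
                   (z = e i \/ z = e j -> win (val z) (val (e p)))).
  split; intros H.
  - assert (Hp : win (val (e i)) (val (e p))) by (apply H; auto).
    apply win_ext; [apply Hp|apply empty_wpair|]; intro z.
    rewrite win_wpair by assumption; split.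
    + intros Hz; destruct (H (elt (HS_win (val_HS (e p)) Hz))) as [Hz' _].
      destruct (Hz' Hz) as [E|E]; [left|right]; now rewrite <- E.
    + intros [->| ->]; apply H; auto.
  - intros z; rewrite H, win_wpair by assumption; split.
    + intros [E|E]; apply val_inj in E; auto.
    + intros [->| ->]; auto.
Qed.

Lemma sat_opair (e : nat -> M) p i j :
  sat M e (opair p i j) <-> val (e p) = wop (val (e i)) (val (e j)).
Proof.
  pose proof (val_HS (e i)) as Hi; pose proof (val_HS (e j)) as Hj.
  set (u := elt (HS_wpair Hi Hi)); set (v := elt (HS_wpair Hi Hj)).
  transitivity (sat M (scons u (scons v e)) (upair (2 + p) 0 1)); [|apply sat_upair].
  assert (E : forall z : M,
    (sat M (scons z e) (upair 0 (1 + i) (1 + i)) \/ sat M (scons z e) (upair 0 (1 + i) (1 + j)))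
    <-> z = u \/ z = v).
  { intros z; rewrite !sat_upair; simpl; split.
    - intros [H|H]; [left|right]; now apply val_inj.
    - intros [->| ->]; auto. }
  split; intros H z; specialize (H z); specialize (E z); cbn [sat] in *; simpl in *; tauto.
Qed.

Lemma sat_app (e : nat -> M) f i j :
  sat M e (Defs.app f i j) <-> win (wop (val (e i)) (val (e j))) (val (e f)).
Proof.
  change (sat M e (Defs.app f i j)) with
    (exists p : M, win (val p) (val (e f)) /\ sat M (scons p e) (opair 0 (1 + i) (1 + j))).
  setoid_rewrite sat_opair; split.
  - intros (p & Hp & E); simpl in E; now rewrite <- E.
  - intros H; exists (elt (HS_wop (val_HS (e i)) (val_HS (e j)))); auto.
Qed.

Definition wbijection f x y : Prop :=
  ∅ ∊ f /\
  (forall p, win p f -> exists a, win a x /\ exists b, win b y /\ p = wop a b) /\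
  (forall a, win a x -> exists b, HS b /\ forall b', HS b' -> (win (wop a b') f <-> b' = b)) /\
  (forall b, win b y -> exists a, HS a /\ forall a', HS a' -> (win (wop a' b) f <-> a' = a)).

Lemma sat_bijection (e : nat -> M) f i j :
  sat M e (bijection f i j) <-> wbijection (val (e f)) (val (e i)) (val (e j)).
Proof.
  assert (Hw : forall (x : M) (P : V -> Prop), (forall a, win a (val x) -> P a) <->
                 (forall a : M, win (val a) (val x) -> P (val a))).
  { intros x P; split; [auto|]; intros H a Ha; apply (H (elt (HS_win (val_HS x) Ha)) Ha). }
  assert (He : forall (x : M) (P : V -> Prop), (exists a, win a (val x) /\ P a) <->
                 (exists a : M, win (val a) (val x) /\ P (val a))).
  { intros x P; split; intros (a & Ha & HP); [|eauto].
    exists (elt (HS_win (val_HS x) Ha)); auto. }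
  assert (Hu : forall P : V -> Prop, (exists b, HS b /\ forall b', HS b' -> (P b' <-> b' = b)) <->
                 (exists b : M, forall b' : M, (P (val b') -> b' = b) /\ (b' = b -> P (val b')))).
  { intros P; split.
    - intros (b & Hb & H); exists (elt Hb); intros b'; split; intros Hb'.
      + apply val_inj, H; [apply val_HS|exact Hb'].
      + apply H; [apply val_HS|now rewrite Hb'].
    - intros (b & H); exists (val b); split; [apply val_HS|]; intros b' Hb'; split; intros E.
      + now rewrite <- (proj1 (H (elt Hb')) E).
      + apply (H (elt Hb')), val_inj, E. }
  unfold wbijection; rewrite !Hw.
  setoid_rewrite He; setoid_rewrite He; setoid_rewrite Hu.
  change (sat M e (bijection f i j)) with
    ((~ ~ ∅ ∊ val (e f)) /\
     (forall p : M, win (val p) (val (e f)) -> exists a : M, win (val a) (val (e i)) /\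
        exists b : M, win (val b) (val (e j)) /\ sat M (scons b (scons a (scons p e))) (opair 2 1 0)) /\
     (forall a : M, win (val a) (val (e i)) -> exists b : M, forall b' : M,
        (sat M (scons b' (scons b (scons a e))) (Defs.app (3 + f) 2 0) -> b' = b) /\
        (b' = b -> sat M (scons b' (scons b (scons a e))) (Defs.app (3 + f) 2 0))) /\
     (forall b : M, win (val b) (val (e j)) -> exists a : M, forall a' : M,
        (sat M (scons a' (scons a (scons b e))) (Defs.app (3 + f) 0 2) -> a' = a) /\
        (a' = a -> sat M (scons a' (scons a (scons b e))) (Defs.app (3 + f) 0 2)))).
  setoid_rewrite sat_opair; setoid_rewrite sat_app.
  assert (NN : ~ ~ ∅ ∊ val (e f) <-> ∅ ∊ val (e f)) by (split; [apply NNPP|tauto]).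
  rewrite NN; reflexivity.
Qed.

Lemma sat_equinumerous (e : nat -> M) i j :
  sat M e (equinumerous i j) <-> exists f, HS f /\ wbijection f (val (e i)) (val (e j)).
Proof.
  change (sat M e (equinumerous i j)) with
    (exists f : M, sat M (scons f e) (bijection 0 (1 + i) (1 + j))).
  setoid_rewrite sat_bijection; split.
  - intros (f & H); exists (val f); split; [apply val_HS|exact H].
  - intros (f & Hf & H); exists (elt Hf); exact H.
Qed.

(** Both sides are enumerated by the same index set [w]. The last hypothesis says that a generator
    moves the two enumerations by the same change of index; this makes the graph that pairs [h i]
    with [g i] invariant. *)
Lemma wbijection_intro (h g : V -> V) w m x y :
  Def (fun e => e 0 = h (e 1)) -> Def (fun e => e 0 = g (e 1)) ->
  HS x -> HS y -> m ∊ ω ->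
  (forall z, win z x <-> exists i, i ∊ w /\ z = h i) ->
  (forall z, win z y <-> exists i, i ∊ w /\ z = g i) ->
  (forall i j, i ∊ w -> j ∊ w -> h i = h j -> i = j) ->
  (forall i j, i ∊ w -> j ∊ w -> g i = g j -> i = j) ->
  (forall c i, G m c -> i ∊ w -> exists j, j ∊ w /\ img c (h i) = h j /\ img c (g i) = g j) ->
  exists f, HS f /\ wbijection f x y.
Proof.
  intros Dh Dg HSx HSy Hm Hx Hy Ih Ig HG.
  assert (HSh : forall i, i ∊ w -> HS (h i)) by (intros; apply (HS_win HSx), Hx; eauto).
  assert (HSg : forall i, i ∊ w -> HS (g i)) by (intros; apply (HS_win HSy), Hy; eauto).
  assert (Dp : DefFun (fun e : nat -> V => wop (h (e 0)) (g (e 0)))).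
  { apply deffun_wop; [apply (deffun1 h Dh)|apply (deffun1 g Dg)]; def. }
  assert (Dp' : Def (fun e : nat -> V => e 0 = wop (h (e 1)) (g (e 1)))) by exact Dp.
  destruct (@HS_comprehension (fun p => exists i, i ∊ w /\ p = wop (h i) (g i))
    (image (fun i => wop (h i) (g i)) w) m) as (f & Hf & Hf0 & _ & Hff).
  - def; apply (def_comp (fun k => match k with 0 => inl 1 | _ => inl 0 end) Dp').
  - intros z (i & Hi & ->); apply HS_wop; auto.
  - intros z Hz; apply (mem_image HV); [exact Dp'|exact Hz].
  - exact Hm.
  - intros c z Hc (i & Hi & ->); destruct (HG c i Hc Hi) as (j & Hj & E1 & E2).
    exists j; split; [exact Hj|]; rewrite img_wop by auto; now rewrite E1, E2.
  - exists f; split; [exact Hf|]; split; [exact Hf0|split; [|split]].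
    + intros p Hp; apply Hff in Hp; destruct Hp as (i & Hi & ->).
      exists (h i); split; [apply Hx; eauto|]; exists (g i); split; [apply Hy; eauto|reflexivity].
    + intros a Ha; apply Hx in Ha; destruct Ha as (i & Hi & ->).
      exists (g i); split; [auto|]; intros b' Hb'; rewrite Hff; split; [|intros ->; eauto].
      intros (j & Hj & E); apply wop_inj in E; auto using HS_nonempty.
      destruct E as [E ->]; now rewrite (Ih i j).
    + intros b Hb; apply Hy in Hb; destruct Hb as (i & Hi & ->).
      exists (h i); split; [auto|]; intros a' Ha'; rewrite Hff; split; [|intros ->; eauto].
      intros (j & Hj & E); apply wop_inj in E; auto using HS_nonempty.
      destruct E as [-> E]; now rewrite (Ig i j).
Qed.

(** [β] injects [V] into the urelements that no map moves, and the members of a pure transitive set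
    are not moved either. The graph of [β] on [κ] is therefore fixed by everything, with support
    [∅]. *)
Lemma model_Plenitude (β : V -> V) : Def (fun e => e 0 = β (e 1)) ->
  (forall a, ~ ∅ ∊ β a /\ β a <> ∅) -> (forall a b, β a = β b -> a = b) ->
  (forall c a, act c (β a) = β a) -> holds M Plenitude.
Proof.
  intros Dβ Hβ Iβ Fβ e κ [(Hset & Htrans & Hsets & _) _].
  change (~ ~ ∅ ∊ val κ) in Hset; apply NNPP in Hset.
  destruct (@separation_def V HV (fun x => win x (val κ)) (val κ)) as [w Hw].
  { apply def_win; def. }
  assert (Hw' : forall x, x ∊ w <-> win x (val κ)).
  { intros x; rewrite Hw; split; [tauto|]; intros H; split; [apply H|exact H]. }
  assert (Fix : forall c a, win a (val κ) -> img c a = a).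
  { intros c a Ha; apply img_pure with w; [..|now apply Hw'].
    - intros x Hx y Hy; apply Hw'; apply Hw' in Hx.
      set (x' := elt (HS_win (val_HS κ) Hx)).
      assert (Hy' : win y (val x')) by exact Hy.
      exact (Htrans x' Hx (elt (HS_win (val_HS x') Hy')) Hy).
    - intros z Hz; apply Hw' in Hz; apply NNPP, (Hsets (elt (HS_win (val_HS κ) Hz)) Hz). }
  assert (Fixβ : forall c a, img c (β a) = β a)
    by (intros; rewrite img_urelement; [apply Fβ|apply Hβ]).
  destruct (@HS_comprehension (fun z => exists i, i ∊ w /\ z = β i) (image β w) ∅)
    as (s & Hs & Hs0 & _ & Hsz).
  - def; apply (def_comp (fun k => match k with 0 => inl 1 | _ => inl 0 end) Dβ).
  - intros z (i & _ & ->); apply HS_urelement; [apply Hβ..|].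
    exists ∅; split; [apply (empty_ω HV)|]; intros c _; apply Fixβ.
  - intros z Hz; apply (mem_image HV); [exact Dβ|exact Hz].
  - apply (empty_ω HV).
  - intros c z _ (i & Hi & ->); rewrite Fixβ; eauto.
  - exists (elt Hs); split; [split|].
    + intros H; apply H, Hs0.
    + intros [z Hz] H; apply Hsz in H; destruct H as (i & _ & E); simpl in *; subst z; apply Hβ.
    + apply sat_equinumerous.
      apply wbijection_intro with β (fun i => i) w ∅; auto; simpl.
      * apply (deffun_var 0).
      * apply (val_HS κ).
      * apply (empty_ω HV).
      * intros z; rewrite <- Hw'; split; [eauto|now intros (i & Hi & ->)].
      * intros c i _ Hi; exists i; split; [exact Hi|split; [apply Fixβ|]].
        apply Fix, Hw', Hi.
Qed.

End Urelements.

(** * The model *)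

Section Swaps.
Local Open Scope zf_scope.
Context {V : structure Empty_set} (HV : models V ZF).
Implicit Types (x y z a b c d j k m n u w : V).

Local Notation "∅" := empty.

Definition triple n k x : V := op n (op k x).

Definition swap a b z : V :=
  if excluded_middle_informative (z = a) then b
  else if excluded_middle_informative (z = b) then a else z.

(** First-order description of [swap], needed for the definability of [act]. *)
Definition swap_graph a b z y : Prop :=
  (z = a /\ y = b) \/ (z <> a /\ z = b /\ y = a) \/ (z <> a /\ z <> b /\ y = z).

Lemma swap_graphE a b z y : swap_graph a b z y <-> y = swap a b z.
Proof.
  unfold swap_graph, swap; repeat destruct excluded_middle_informative; intuition congruence.
Qed.

Ltac swap_cases := unfold swap; repeat destruct excluded_middle_informative; congruence || auto.

Lemma swap_invol a b z : swap a b (swap a b z) = z.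
Proof. swap_cases. Qed.

Lemma swap_same a z : swap a a z = z.
Proof. swap_cases. Qed.

Lemma swap_left a b : swap a b a = b.
Proof. swap_cases. Qed.

Lemma swap_other a b z : z <> a -> z <> b -> swap a b z = z.
Proof. intros; swap_cases. Qed.

Lemma swap_commute a b c d z : a <> c -> a <> d -> b <> c -> b <> d ->
  swap a b (swap c d z) = swap c d (swap a b z).
Proof. intros; swap_cases. Qed.

Lemma swap_in (P : V -> Prop) a b z : P a -> P b -> P z -> P (swap a b z).
Proof. intros; swap_cases. Qed.

Lemma triple_inj n k x n' k' x' : triple n k x = triple n' k' x' -> n = n' /\ k = k' /\ x = x'.
Proof. intros E; apply (op_inj HV) in E; destruct E as [-> E]; now apply (op_inj HV) in E. Qed.

Lemma deffun_triple f g h : DefFun f -> DefFun g -> DefFun h ->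
  DefFun (fun e => triple (f e) (g e) (h e)).
Proof. intros; unfold triple; def. Qed.

(** * Codes of transpositions and their action on urelements *)

Definition code n k k' x x' : V := op n (op (op k k') (op x x')).

Definition valid n k k' x x' : Prop := n ∊ ω /\ x ∊ ω /\ x' ∊ ω /\ k <> ∅ /\ k' <> ∅.

(* [code n k k' x x'] acts on the urelements [triple n j z] with z ∊ ω by
   exchanging the columns k, k' and the rows x, x', and fixes all others. *)
Definition act_graph c u y : Prop :=
  (exists n k k' x x' j z j' z', valid n k k' x x' /\ c = code n k k' x x' /\ z ∊ ω /\
     u = triple n j z /\ swap_graph k k' j j' /\ swap_graph x x' z z' /\ y = triple n j' z') \/
  (~ (exists n k k' x x' j z, valid n k k' x x' /\ c = code n k k' x x' /\ z ∊ ω /\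
     u = triple n j z) /\ y = u).

Definition act c u : V := epsilon (dom_inhabited V) (act_graph c u).

(** In each disjunction the equality means that the corresponding swap is the identity. For natural
    numbers, not to be a member of [m] is to be at least [m]. *)
Definition level m c : Prop := exists n k k' x x', valid n k k' x x' /\ c = code n k k' x x' /\
  (x = x' \/ ~ x ∊ m /\ ~ x' ∊ m) /\ (k = k' \/ ~ n ∊ m).

Lemma code_inj n k l x y n' k' l' x' y' : code n k l x y = code n' k' l' x' y' ->
  n = n' /\ k = k' /\ l = l' /\ x = x' /\ y = y'.
Proof.
  intros E; apply (op_inj HV) in E; destruct E as [-> E]; apply (op_inj HV) in E.
  destruct E as [E1 E2]; apply (op_inj HV) in E1, E2; tauto.
Qed.

Lemma act_graphE c u y : act_graph c u y <-> y = act c u.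
Proof.
  assert (Hex : exists y, act_graph c u y).
  { destruct (classic (exists n k k' x x' j z, valid n k k' x x' /\ c = code n k k' x x' /\
      z ∊ ω /\ u = triple n j z)) as [(n & k & k' & x & x' & j & z & H1 & H2 & H3 & H4)|H].
    - exists (triple n (swap k k' j) (swap x x' z)); left.
      exists n, k, k', x, x', j, z, (swap k k' j), (swap x x' z).
      rewrite !swap_graphE; tauto.
    - exists u; right; auto. }
  assert (Huniq : forall y y', act_graph c u y -> act_graph c u y' -> y = y').
  { intros y1 y2 [H1|[H1 ->]] [H2|[H2 ->]]; [| | |reflexivity].
    - destruct H1 as (n & k & k' & x & x' & j & z & j' & z' & _ & Hc & _ & Hu & Hj & Hz & ->).
      destruct H2 as (n2 & k2 & k2' & x2 & x2' & j2 & z2 & j2' & z2' & _ & Hc2 & _ & Hu2 & Hj2 & Hz2 & ->).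
      subst c u; apply triple_inj in Hu2; apply code_inj in Hc2.
      destruct Hc2 as (-> & -> & -> & -> & ->), Hu2 as (_ & -> & ->).
      rewrite swap_graphE in *; congruence.
    - destruct H2; destruct H1 as (n & k & k' & x & x' & j & z & j' & z' & H1); do 7 eexists; intuition eauto.
    - destruct H1; destruct H2 as (n & k & k' & x & x' & j & z & j' & z' & H2); do 7 eexists; intuition eauto. }
  pose proof (epsilon_spec (dom_inhabited V) _ Hex) as H.
  split; [intros Hy; exact (Huniq _ _ Hy H)|intros ->; exact H].
Qed.

Lemma act_triple n k k' x x' j z : valid n k k' x x' -> z ∊ ω ->
  act (code n k k' x x') (triple n j z) = triple n (swap k k' j) (swap x x' z).
Proof.
  intros Hv Hz; symmetry; apply act_graphE; left.
  exists n, k, k', x, x', j, z, (swap k k' j), (swap x x' z); rewrite !swap_graphE; tauto.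
Qed.

Lemma act_other n k k' x x' u : (forall j z, z ∊ ω -> u <> triple n j z) ->
  act (code n k k' x x') u = u.
Proof.
  intros Hu; symmetry; apply act_graphE; right; split; [|reflexivity].
  intros (n2 & k2 & k2' & x2 & x2' & j & z & _ & Hc & Hz & E).
  apply code_inj in Hc; destruct Hc as (<- & _); now apply (Hu j z).
Qed.

Lemma act_invalid c u : (forall n k k' x x', valid n k k' x x' -> c <> code n k k' x x') ->
  act c u = u.
Proof.
  intros H; symmetry; apply act_graphE; right; split; [|reflexivity].
  intros (n & k & k' & x & x' & j & z & Hv & Hc & _); now apply (H n k k' x x').
Qed.

Lemma valid_cases c : (exists n k k' x x', valid n k k' x x' /\ c = code n k k' x x') \/
  (forall n k k' x x', valid n k k' x x' -> c <> code n k k' x x').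
Proof.
  destruct (classic (exists n k k' x x', valid n k k' x x' /\ c = code n k k' x x')) as [|H];
    [now left|right]; intros n k k' x x' Hv Hc; apply H; exists n, k, k', x, x'; auto.
Qed.

Lemma triple_cases n u : (exists j z, z ∊ ω /\ u = triple n j z) \/
  (forall j z, z ∊ ω -> u <> triple n j z).
Proof.
  destruct (classic (exists j z, z ∊ ω /\ u = triple n j z)) as [|H]; [now left|right].
  intros j z Hz E; apply H; eauto.
Qed.

Lemma op_urelement a b : ~ ∅ ∊ op a b.
Proof.
  intros H; apply (mem_pairset HV) in H; destruct H as [E|E];
    apply (@mem_empty V HV a); rewrite E; apply (mem_pairset HV); auto.
Qed.

Lemma op_nonempty a b : op a b <> ∅.
Proof.
  intros E; apply (@mem_empty V HV (sing a)); rewrite <- E; apply (mem_pairset HV); auto.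
Qed.

Lemma act_def : Def (fun e : nat -> V => e 0 = act (e 1) (e 2)).
Proof.
  apply def_iff_mono with (fun e => act_graph (e 1) (e 2) (e 0)); [intro; apply act_graphE|].
  unfold act_graph, swap_graph, valid, code, triple; def.
Qed.

Lemma level_def : Def (fun e : nat -> V => level (e 0) (e 1)).
Proof. unfold level, valid, code; def. Qed.

Lemma act_cases c u : act c u = u \/
  exists n k k' x x' j z, valid n k k' x x' /\ c = code n k k' x x' /\ z ∊ ω /\ u = triple n j z.
Proof.
  destruct (valid_cases c) as [(n & k & k' & x & x' & Hv & ->)|H]; [|left; now apply act_invalid].
  destruct (triple_cases n u) as [(j & z & Hz & ->)|H]; [|left; now apply act_other].
  right; exists n, k, k', x, x', j, z; auto.
Qed.

Lemma act_urelement c u : ~ ∅ ∊ u -> ~ ∅ ∊ act c u.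
Proof.
  intros Hu; destruct (act_cases c u) as [->|(n & k & k' & x & x' & j & z & Hv & -> & Hz & ->)];
    [exact Hu|]; rewrite act_triple by assumption; apply op_urelement.
Qed.

Lemma act_nonempty c u : ~ ∅ ∊ u -> u <> ∅ -> act c u <> ∅.
Proof.
  intros _ Hu; destruct (act_cases c u) as [->|(n & k & k' & x & x' & j & z & Hv & -> & Hz & ->)];
    [exact Hu|]; rewrite act_triple by assumption; apply op_nonempty.
Qed.

Lemma act_invol c u : ~ ∅ ∊ u -> act c (act c u) = u.
Proof.
  intros _; destruct (act_cases c u) as [E|(n & k & k' & x & x' & j & z & Hv & -> & Hz & ->)].
  - now rewrite E.
  - rewrite !act_triple; auto.
    + now rewrite !swap_invol.
    + apply (swap_in (fun x => x ∊ ω)); auto; apply Hv.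
Qed.

Lemma level_mono m n c : (forall k, k ∊ m -> k ∊ n) -> level n c -> level m c.
Proof.
  intros H (n' & k & k' & x & x' & Hv & Hc & H1 & H2); exists n', k, k', x, x'.
  repeat split; auto; [apply Hv..| |].
  - destruct H1 as [|[]]; [now left|right; auto].
  - destruct H2; [now left|right; auto].
Qed.

Lemma ω_above3 n x y : n ∊ ω -> x ∊ ω -> y ∊ ω -> exists m, m ∊ ω /\ n ∊ m /\ x ∊ m /\ y ∊ m.
Proof.
  intros Hn Hx Hy.
  destruct (ω_directed HV n x Hn Hx) as (m1 & Hm1 & S1 & S2).
  destruct (ω_directed HV m1 y Hm1 Hy) as (m2 & Hm2 & S3 & S4).
  exists (suc m2); split; [now apply suc_ω|].
  assert (Hle : forall a, a ∊ ω -> (forall b, b ∊ a -> b ∊ m2) -> a ∊ suc m2).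
  { intros a Ha Hab; apply (mem_suc HV); destruct (ω_linear HV a m2 Ha Hm2) as [|[->|H]]; auto.
    exfalso; apply (no_loop HV m2); auto. }
  repeat split; apply Hle; auto.
Qed.

(** Choose [m] above [n], [x] and [x']. A map of level [m] with the same index [n] exchanges no
    columns, and its rows are either equal or different from [x] and [x']; a map with another index
    moves other urelements. *)
Lemma level_commute c : exists m, m ∊ ω /\ forall d, level m d -> forall u, ~ ∅ ∊ u ->
  act c (act d u) = act d (act c u).
Proof.
  destruct (valid_cases c) as [(n & k & k' & x & x' & Hv & ->)|H].
  2:{ exists ∅; split; [apply (empty_ω HV)|]; intros; now rewrite !(@act_invalid c). }
  destruct (@ω_above3 n x x') as (m & Hm & H1 & H2 & H3); try apply Hv.
  exists m; split; [exact Hm|].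
  intros d (n2 & l & l' & y & y' & Hv2 & -> & Hy & Hl) u _.
  assert (Hin : forall a b z, a ∊ ω -> b ∊ ω -> z ∊ ω -> swap a b z ∊ ω)
    by (intros; apply (swap_in (fun x => x ∊ ω)); auto).
  destruct (classic (n = n2)) as [<-|Hne].
  - destruct (triple_cases n u) as [(j & z & Hz & ->)|Hu]; [|now rewrite !(act_other _ _ _ _ _ Hu)].
    rewrite !act_triple; try apply Hin; auto; try apply Hv; try apply Hv2.
    destruct Hl as [<-|]; [|tauto]; rewrite !swap_same; f_equal.
    destruct Hy as [<-|[]]; [now rewrite !swap_same|].
    apply swap_commute; intros ->; auto.
  - assert (Hd : forall j z j' z', triple n j z <> triple n2 j' z')
      by (intros j z j' z' E; apply triple_inj in E; tauto).
    destruct (triple_cases n u) as [(j & z & Hz & ->)|Hu].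
    + rewrite (@act_other n2), act_triple by auto; now rewrite act_other by auto.
    + rewrite (@act_other n) with (u := u) by auto.
      destruct (triple_cases n2 u) as [(j & z & Hz & ->)|Hu2].
      * rewrite act_triple by auto; rewrite act_other by auto; reflexivity.
      * rewrite (@act_other n2) by auto; now apply act_other.
Qed.

End Swaps.

(** * Columns, and the failure of Collection and Duplication *)

Section Failure.
Local Open Scope zf_scope.
Context {V : structure Empty_set} (HV : models V ZF).
Implicit Types (x y z a b c d j k m n u w : V).

Local Notation "∅" := empty.

Definition swap_model : structure lang :=
  symmetric_model HV act (act_def HV) (act_urelement HV) (act_nonempty HV) (act_invol HV) level.

Local Notation M := swap_model.
Local Notation HSym := (HS act level).
Local Notation Img := (img act).

Let comprehension := @HS_comprehension V HV act (act_def HV) (act_urelement HV)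
  (act_nonempty HV) (act_invol HV) level.
Let bijection_intro := @wbijection_intro V HV act (act_def HV) (act_urelement HV)
  (act_nonempty HV) (act_invol HV) level (@level_mono V) (level_commute HV).
Let Img_win := @img_win V HV act (act_def HV) (act_urelement HV) (act_nonempty HV) (act_invol HV).
Let Img_wop := @img_wop V HV act (act_def HV) (act_urelement HV) (act_nonempty HV) (act_invol HV)
  level (@level_mono V) (level_commute HV).
Let element := @elt V HV act (act_def HV) (act_urelement HV) (act_nonempty HV) (act_invol HV) level.
Let equinumerousE := @sat_equinumerous V HV act (act_def HV) (act_urelement HV)
  (act_nonempty HV) (act_invol HV) level (@level_mono V).

Lemma triple_urelement n k x : ~ ∅ ∊ triple n k x.
Proof. apply (op_urelement HV). Qed.

Lemma img_triple n k k' x x' j z : valid n k k' x x' -> z ∊ ω ->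
  Img (code n k k' x x') (triple n j z) = triple n (swap k k' j) (swap x x' z).
Proof.
  intros; rewrite (img_urelement HV) by apply triple_urelement; now apply act_triple.
Qed.

Lemma img_other n k k' x x' u : ~ ∅ ∊ u -> (forall j z, z ∊ ω -> u <> triple n j z) ->
  Img (code n k k' x x') u = u.
Proof. intros; rewrite (img_urelement HV) by assumption; now apply act_other. Qed.

(** The new row [z'] is chosen before [k]: a map of level [m] moves all columns that it does not
    exchange in the same way. This is what makes the matching between (n, {∅}) and (n, ∅)
    symmetric. *)
Lemma img_row m c n z : level m c -> z ∊ ω -> exists z', z' ∊ ω /\
  (forall k, k = ∅ \/ n ∊ m -> Img c (triple n k z) = triple n k z') /\ (z ∊ m -> z' = z).
Proof.
  intros (n2 & l & l' & x & x' & Hv & -> & Hx & Hl) Hz.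
  destruct (classic (n = n2)) as [<-|Hne].
  - exists (swap x x' z); split; [apply (swap_in (fun x => x ∊ ω)); auto; apply Hv|split].
    + intros k Hk; rewrite img_triple by assumption; f_equal.
      destruct Hk as [->|Hk].
      * apply swap_other; apply not_eq_sym, Hv.
      * destruct Hl as [<-|]; [apply swap_same|tauto].
    + intros Hzm; destruct Hx as [<-|[]]; [apply swap_same|].
      apply swap_other; intros ->; auto.
  - exists z; split; [exact Hz|split; [|reflexivity]]; intros k _.
    apply img_other; [apply triple_urelement|].
    intros j z' _ E; apply (triple_inj HV) in E; tauto.
Qed.

Lemma HS_triple n k x : n ∊ ω -> x ∊ ω -> HSym (triple n k x).
Proof.
  intros Hn Hx; apply (HS_urelement HV); [apply triple_urelement|apply (op_nonempty HV)|].
  destruct (@ω_above3 V HV n x x) as (m & Hm & H1 & H2 & _); auto.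
  exists m; split; [exact Hm|]; intros c Hc.
  destruct (@img_row m c n x Hc Hx) as (x' & _ & H3 & H4); rewrite H3, H4; auto.
Qed.

Definition column n k : V := setof (fun z => z = ∅ \/ exists x, x ∊ ω /\ z = triple n k x).

Lemma def_triple n k : Def (fun e : nat -> V => e 0 = triple n k (e 1)).
Proof. apply (@deffun_triple V HV (fun _ => n) (fun _ => k) (fun e => e 0)); def. Qed.

Lemma small_column n k : small (fun z => z = ∅ \/ exists x, x ∊ ω /\ z = triple n k x).
Proof.
  apply (small_sub HV) with (bunion (sing ∅) (image (triple n k) ω)).
  - unfold triple; def.
  - intros z [->|H]; apply (mem_bunion HV); [left; now apply (mem_sing HV)|right].
    apply (mem_image HV); [apply def_triple|exact H].
Qed.

Lemma win_column n k z : win z (column n k) <-> exists x, x ∊ ω /\ z = triple n k x.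
Proof.
  unfold win, column; rewrite !mem_setof by apply small_column; split; [tauto|].
  intros (x & Hx & ->); split; [apply (op_nonempty HV)|split; eauto].
Qed.

Lemma empty_column n k : ∅ ∊ column n k.
Proof. unfold column; rewrite mem_setof by apply small_column; auto. Qed.

Lemma deffun_column f g : DefFun f -> DefFun g -> DefFun (fun e => column (f e) (g e)).
Proof.
  apply deffun2.
  apply (@deffun_setof V HV (fun e z => z = ∅ \/ exists x, x ∊ ω /\ z = triple (e 0) (e 1) x)).
  - intro; apply small_column.
  - unfold triple; def.
Qed.

Lemma def_column k : Def (fun e : nat -> V => e 0 = column (e 1) k).
Proof. apply (@deffun_column (fun e => e 0) (fun _ => k)); def. Qed.

Lemma HS_column m n k : m ∊ ω -> n ∊ ω -> k = ∅ \/ n ∊ m ->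
  HSym (column n k) /\ supports act level m (column n k).
Proof.
  intros Hm Hn Hk.
  destruct (@comprehension (fun z => exists x, x ∊ ω /\ z = triple n k x) (column n k) m)
    as (s & Hs & H0 & Hsup & Hz).
  - unfold triple; def.
  - intros z (x & Hx & ->); now apply HS_triple.
  - intros z H; apply win_column in H; apply H.
  - exact Hm.
  - intros c z Hc (x & Hx & ->).
    destruct (@img_row m c n x Hc Hx) as (x' & Hx' & H1 & _); rewrite H1; eauto.
  - replace (column n k) with s; [auto|].
    apply (win_ext HV); [exact H0|apply empty_column|]; intro z; now rewrite Hz, win_column.
Qed.

Lemma columns_exist : exists W, HSym W /\ ∅ ∊ W /\
  forall z, win z W <-> exists n, n ∊ ω /\ z = column n ∅.
Proof.
  destruct (@comprehension (fun z => exists n, n ∊ ω /\ z = column n ∅)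
    (image (fun n => column n ∅) ω) ∅) as (s & Hs & H0 & _ & Hz).
  - def; apply deffun_column; def.
  - intros z (n & Hn & ->); apply (@HS_column ∅); auto; apply (empty_ω HV).
  - intros z Hz; apply (mem_image HV); [apply def_column|exact Hz].
  - apply (empty_ω HV).
  - intros c z Hc (n & Hn & ->); exists n; split; [exact Hn|].
    apply (@HS_column ∅); auto; apply (empty_ω HV).
  - now exists s.
Qed.

Lemma base_exists : exists A, HSym A /\ ∅ ∊ A /\
  forall z, win z A <-> exists n x, n ∊ ω /\ x ∊ ω /\ z = triple n ∅ x.
Proof.
  destruct (@comprehension (fun z => exists n x, n ∊ ω /\ x ∊ ω /\ z = triple n ∅ x)
    (bigunion (image (fun n => column n ∅) ω)) ∅) as (s & Hs & H0 & _ & Hz).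
  - unfold triple; def.
  - intros z (n & x & Hn & Hx & ->); now apply HS_triple.
  - intros z (n & x & Hn & Hx & ->); apply (mem_bigunion HV); exists (column n ∅); split.
    + apply (mem_image HV); [apply def_column|]; eauto.
    + apply win_column; eauto.
  - apply (empty_ω HV).
  - intros c z Hc (n & x & Hn & Hx & ->).
    destruct (@img_row ∅ c n x Hc Hx) as (x' & Hx' & H1 & _); rewrite H1; eauto 6.
  - now exists s.
Qed.

Lemma sing_nonempty a : sing a <> ∅.
Proof. intros E; apply (@mem_empty V HV a); rewrite <- E; now apply (mem_sing HV). Qed.

(* All columns k ≠ ∅ of an index n outside m are exchanged by elements of [level m],
   and there is a proper class of them. *)
Lemma no_unbounded_column (P : V -> Prop) m n j z s :
  (forall u, P u -> u ∊ s) -> (forall c u, level m c -> P u -> P (Img c u)) ->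
  n ∊ ω -> ~ n ∊ m -> z ∊ ω -> j <> ∅ -> ~ P (triple n j z).
Proof.
  intros Hs HP Hn Hm Hz Hj HPj.
  (* [k] lies four membership steps below [triple n k z], through [sing k], [op k z] and
     [pairset n (op k z)]; hence the four unions. *)
  assert (Hall : forall k, k <> ∅ -> k ∊ bigunion (bigunion (bigunion (bigunion s)))).
  { intros k Hk.
    assert (Hv : valid n j k ∅ ∅) by (repeat split; auto; apply (empty_ω HV)).
    assert (HPk : P (triple n k z)).
    { replace (triple n k z) with (Img (code n j k ∅ ∅) (triple n j z)).
      - apply HP; [|exact HPj]; exists n, j, k, ∅, ∅; auto.
      - rewrite img_triple by assumption; now rewrite swap_left, swap_same. }
    rewrite (mem_bigunion HV); exists (sing k); split; [|now apply (mem_sing HV)].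
    rewrite (mem_bigunion HV); exists (op k z); split; [|apply (mem_pairset HV); auto].
    rewrite (mem_bigunion HV); exists (pairset n (op k z)); split; [|apply (mem_pairset HV); auto].
    rewrite (mem_bigunion HV); exists (triple n k z); split; [auto|apply (mem_pairset HV); auto]. }
  (* The union itself is taken for [k]. It differs from [∅] because [j] is one of its members. *)
  apply (no_loop HV (bigunion (bigunion (bigunion (bigunion s))))), Hall.
  intros E; apply (@mem_empty V HV j); rewrite <- E; now apply Hall.
Qed.

(* Transposing two rows of index n outside the support of a bijection f moves
   triple n ∅ m but not its preimage. *)
Lemma no_copy f x y n : HSym f -> HSym x -> HSym y -> wbijection act level f y x -> n ∊ ω ->
  (forall z, z ∊ ω -> win (triple n ∅ z) x) ->
  (forall u, win u y -> ~ ∅ ∊ u) ->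
  (forall j z, z ∊ ω -> ~ win (triple n j z) y) -> False.
Proof.
  intros Hf HSx HSy (_ & Hsub & Hfun & Hinj) Hn Hx Hy Hno.
  destruct (HS_symmetric Hf) as (m & Hm & Sup).
  (* The rows [m] and [suc m] are both outside [m], so their transposition belongs to level [m] and
     fixes [f]. *)
  set (b := triple n ∅ m).
  assert (Hb : HSym b) by now apply HS_triple.
  destruct (Hinj b (Hx m Hm)) as (a & Ha & Hab).
  assert (Hfab : win (wop a b) f) by now apply Hab.
  assert (Hay : win a y).
  { destruct (Hsub _ Hfab) as (a' & Ha' & b' & Hb' & E).
    apply (wop_inj HV) in E; try (eapply HS_nonempty; eassumption).
    - destruct E as [-> _]; exact Ha'.
    - exact (HS_nonempty (HS_win HSy Ha')).
    - exact (HS_nonempty (HS_win HSx Hb')). }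
  (* An arbitrary nonempty column index, used twice in the code so that no columns are exchanged. *)
  set (l := sing ∅ : V).
  assert (Hv : valid n l l m (suc m)).
  { repeat split; auto; try apply sing_nonempty; now apply (suc_ω HV). }
  assert (Hmm : m ∊ suc m) by (apply (mem_suc HV); auto).
  assert (Hc : level m (code n l l m (suc m))).
  { exists n, l, l, m, (suc m); repeat split; auto; try apply Hv.
    right; split; [apply (no_loop HV)|now apply (no_loop2 HV)]. }
  assert (H1 : win (wop a (triple n ∅ (suc m))) f).
  { replace (wop a (triple n ∅ (suc m))) with (Img (code n l l m (suc m)) (wop a b)).
    - rewrite <- (Sup _ Hc); apply Img_win; [..|exact Hfab]; apply (@HS_hereditary V act level).
      + now apply (HS_wop HV (act_def HV) (act_urelement HV) (act_nonempty HV) (act_invol HV)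
                     (@level_mono V)).
      + exact Hf.
    - rewrite Img_wop by assumption; f_equal.
      + apply img_other; [now apply Hy|]; intros j z Hz ->; now apply (Hno j z).
      + unfold b; rewrite img_triple by assumption; now rewrite swap_same, swap_left. }
  destruct (Hfun a Hay) as (b' & _ & Hb').
  rewrite Hb' in Hfab by exact Hb.
  rewrite Hb' in H1 by (apply HS_triple; auto; now apply (suc_ω HV)).
  unfold b in Hfab; rewrite <- H1 in Hfab; apply (triple_inj HV) in Hfab.
  destruct Hfab as (_ & _ & E); rewrite <- E in Hmm; now apply (no_loop HV) in Hmm.
Qed.

(** * Verification of the four properties *)

Lemma swap_model_ZFU_R : models M ZFU_R.
Proof. apply model_ZFU_R; [apply (level_def HV)|apply level_mono|apply (level_commute HV)]. Qed.

Lemma swap_model_Plenitude : holds M Plenitude.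
Proof.
  (* Only urelements with first coordinate in [ω] are ever moved, and [ω] is not a member of
     itself. *)
  apply model_Plenitude with (β := fun a => op ω a).
  - apply level_mono.
  - apply (level_commute HV).
  - apply (@deffun_op V HV (fun _ => ω) (fun e => e 0)); def.
  - intros a; split; [apply (op_urelement HV)|apply (op_nonempty HV)].
  - intros a b E; now apply (op_inj HV) in E.
  - intros c a; destruct (valid_cases c) as [(n & k & k' & x & x' & Hv & ->)|H];
      [|now apply act_invalid].
    apply (act_other HV); intros j z _ E; apply (op_inj HV) in E; destruct E as [E _].
    destruct Hv as [Hn _]; rewrite <- E in Hn; now apply (no_loop HV) in Hn.
Qed.

Lemma swap_model_not_Duplication : ~ holds M Duplication.
Proof.
  intros HD; destruct base_exists as (A & HA & HA0 & HzA).
  specialize (HD (fun _ => element HA) (element HA)).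
  destruct HD as (B & [HB HBu] & Hdisj & Heq).
  - split; [intros H; now apply H|]; intros [u Hu] Hw; apply HzA in Hw.
    destruct Hw as (n & x & _ & _ & E); simpl in E |- *; subst u; apply triple_urelement.
  - apply equinumerousE in Heq; destruct Heq as (f & Hf & Hbij).
    change (wbijection act level f (val B) A) in Hbij.
    pose proof (val_HS B) as HSB.
    destruct (HS_symmetric HSB) as (m & Hm & Sup).
    (* The index n is taken to be [m], the least one outside the support of [B]. Then [B] misses the
       column (m, ∅) by disjointness from [A], and the other columns of index m because they would
       be unbounded. *)
    apply (@no_copy f A (val B) m); auto.
    + intros z Hz; apply HzA; eauto 6.
    + intros u Hu; exact (HBu (element (HS_win HSB Hu)) Hu).
    + intros j z Hz Hw; destruct (classic (j = ∅)) as [->|Hj].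
      * apply Hdisj; exists (element (HS_win HSB Hw)); split; [exact Hw|].
        apply HzA; eauto 6.
      * revert Hw; apply (@no_unbounded_column (fun u => win u (val B)) m m j z (val B)); auto.
        -- intros u Hu; apply Hu.
        -- intros c u Hc Hu; rewrite <- (Sup c Hc).
           apply Img_win; [eapply HS_hereditary, HS_win; eassumption|eapply HS_hereditary; eassumption|exact Hu].
        -- apply (no_loop HV).
Qed.

(* Variable 1 is a set of urelements disjoint from variable 2 and equinumerous with
   variable 0. *)
Definition copy_formula : form lang :=
  And (set_of_urelements 1)
    (And (Imp (Ex (And (Mem 0 2) (Mem 0 3))) Bot) (equinumerous 1 0)).

Lemma sat_copy_formula (e : nat -> M) : sat M e copy_formula <->
  (∅ ∊ val (e 1) /\ forall u, win u (val (e 1)) -> ~ ∅ ∊ u) /\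
  (forall u, win u (val (e 1)) -> ~ win u (val (e 2))) /\
  exists f, HSym f /\ wbijection act level f (val (e 1)) (val (e 0)).
Proof.
  rewrite <- equinumerousE.
  change (sat M e copy_formula) with
    ((~ ~ ∅ ∊ val (e 1) /\ forall u : M, win (val u) (val (e 1)) -> ~ ∅ ∊ val u) /\
     (~ exists u : M, win (val u) (val (e 1)) /\ win (val u) (val (e 2))) /\
     sat M e (equinumerous 1 0)).
  pose proof (val_HS (e 1)) as HS1.
  split; intros ((H1 & H2) & H3 & H4); (split; [split|split; [|exact H4]]).
  - now apply NNPP.
  - intros u Hu; exact (H2 (element (HS_win HS1 Hu)) Hu).
  - intros u Hu Hu'; apply H3; exists (element (HS_win HS1 Hu)); auto.
  - tauto.
  - auto.
  - intros (u & Hu & Hu'); now apply (H3 (val u)).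
Qed.

Lemma swap_model_not_Collection : ~ models M (@Collection lang).
Proof.
  intros HC; destruct base_exists as (A & HA & HA0 & HzA), columns_exist as (W & HW & HW0 & HzW).
  pose proof (HC _ (Collection_instance copy_formula)) as C; unfold collection in C.
  rewrite holds_close in C.
  specialize (C (fun _ => element HA) (element HW)); cbn [sat] in C.
  setoid_rewrite sat_ren in C; setoid_rewrite sat_copy_formula in C.
  destruct C as (v & Hv).
  - intros [x HSx] Hx; change (win x W) in Hx; apply HzW in Hx.
    destruct Hx as (n & Hn & ->); simpl.
    assert (Hmn : suc n ∊ ω) by now apply (suc_ω HV).
    assert (Hnn : n ∊ suc n) by (apply (mem_suc HV); auto).
    (* Support [suc n] is large enough to exclude column exchanges at index n. It grows with n, so
       these witnesses have no evident common support. *)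
    destruct (@HS_column (suc n) n (sing ∅)) as [HSc _]; auto.
    exists (element HSc); change (val _) with (column n (sing ∅)) at 1 2 3 4.
    split; [split|split].
    + apply empty_column.
    + intros u Hu; apply win_column in Hu; destruct Hu as (x & _ & ->); apply triple_urelement.
    + intros u Hu Hu'; apply win_column in Hu; apply HzA in Hu'.
      destruct Hu as (x & _ & ->), Hu' as (n' & x' & _ & _ & E).
      apply (triple_inj HV) in E; destruct E as (_ & E & _); now apply sing_nonempty in E.
    (* The two columns are matched row by row. *)
    + apply bijection_intro with (triple n (sing ∅)) (triple n ∅) ω (suc n); auto.
      * apply def_triple.
      * apply def_triple.
      * intros z; apply win_column.
      * intros z; apply win_column.
      * intros i j _ _ E; now apply (triple_inj HV) in E.
      * intros i j _ _ E; now apply (triple_inj HV) in E.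
      * intros c i Hc Hi; destruct (@img_row (suc n) c n i Hc Hi) as (i' & Hi' & H1 & _).
        exists i'; split; [exact Hi'|split; apply H1; auto].
  - destruct (HS_symmetric (val_HS v)) as (m & Hm & Sup).
    (* The support [m] of the collecting set [v] is itself the index of the column whose copy cannot
       be in [v]. *)
    destruct (@HS_column ∅ m ∅) as [HSm _]; auto; [apply (empty_ω HV)|].
    destruct (Hv (element HSm)) as (y & Hy & (Hy0 & Hyu) & Hdisj & f & Hf & Hbij).
    { apply HzW; eauto. }
    simpl in Hbij, Hdisj, Hyu.
    apply (@no_copy f (column m ∅) (val y) m); auto; [apply val_HS|..].
    + intros z Hz; apply win_column; eauto.
    + intros j z Hz Hw; destruct (classic (j = ∅)) as [->|Hj].
      * apply (Hdisj _ Hw), HzA; eauto 6.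
      * assert (HP : exists y', win y' (val v) /\ win (triple m j z) y') by (exists (val y); auto).
        revert HP.
        (* The copy [y] need not have support [m], but [v] has; so the argument is applied to the
           members of members of [v]. *)
        apply (@no_unbounded_column (fun u => exists y', win y' (val v) /\ win u y')
                 m m j z (bigunion (val v))); auto.
        -- intros u (y' & H1 & H2); apply (mem_bigunion HV); exists y'; split; [apply H1|apply H2].
        -- intros c u Hc (y' & H1 & H2); exists (Img c y').
           assert (HSy' : HSym y') by exact (HS_win (val_HS v) H1).
           split; [rewrite <- (Sup c Hc)|]; apply Img_win;
             eauto using HS_hereditary, HS_win, val_HS.
        -- apply (no_loop HV).
Qed.

End Failure.

Theorem theorem2p28 :
  consistent ZF ->
  exists M : structure lang,
    models M ZFU_R /\ holds M Plenitude /\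
    ~ models M (@Collection lang) /\ ~ holds M Duplication.
Proof.
  intros HZF; destruct (ZF_model HZF) as [V HV]; exists (swap_model HV).
  split; [apply swap_model_ZFU_R|split; [apply swap_model_Plenitude|]].
  split; [apply swap_model_not_Collection|apply swap_model_not_Duplication].
Qed.
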